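(* Let $n\geq 2$, let $\Omega\subset\mathbb{R}^n$ be a domain, and let $F:\Omega\times\mathbb{R}^n\to[0,\infty)$ be an admissible Finsler structure on $\Omega$. If $F$ is weak upper semicontinuous on $\Omega$, then the intrinsic distance and differential structures coincide; that is, for every function $u:\Omega\to\mathbb{R}$ that is Lipschitz with respect to the Euclidean distance, one has $$\operatorname{Lip}_{\delta_F}u(x)=F(x,du(x))\qquad\text{for almost every } x\in\Omega.$$
   Context: A domain is an open connected set; ''almost every'' (a.e.) refers to $n$-dimensional Lebesgue measure. Finsler structure: a function $F:\Omega\times\mathbb{R}^n\to[0,\infty)$ is a Finsler structure on $\Omega$ if (i) $F(\cdot,v)$ is Borel measurable for all $v\in\mathbb{R}^n$, and $F(x,\cdot)$ is continuous for a.e. $x\in\Omega$; (ii) $F(x,v)>0$ for a.e. $x$ if $v\neq 0$; (iii) $F(x,\lambda v)=|\lambda|F(x,v)$ for a.e. $x\in\Omega$ and all $\lambda\in\mathbb{R}$, $v\in\mathbb{R}^n$. Admissible: a Finsler structure $F$ is admissible if (i) $F(x,\cdot)$ is convex for a.e. $x\in\Omega$; (ii) there is a continuous function $\lambda:\Omega\to[1,\infty)$ such that $\frac{1}{\lambda(x)}|v|\leq F(x,v)\leq\lambda(x)|v|$ for a.e. $x\in\Omega$ and all $v\in\mathbb{R}^n$. Weak upper semicontinuity: a function $w:\Omega\to\mathbb{R}$ is upper semicontinuous at $x$ if $w(x)\geq\limsup_{y\to x}w(y)$, and weak upper semicontinuous in $\Omega$ if it is upper semicontinuous at almost every $x\in\Omega$.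 An admissible Finsler structure $F$ is weak upper semicontinuous on $\Omega$ if for each $v\in\mathbb{R}^n$ the function $F(\cdot,v)$ is weak upper semicontinuous in $\Omega$. Differential: for a Lipschitz function $u$, $du(x)$ denotes its differential at $x$, which exists for a.e. $x$ by Rademacher's theorem, identified with a vector of $\mathbb{R}^n$ via the standard inner product. Intrinsic distance: $$\delta_F(x,y)=\sup\big\{u(x)-u(y): u:\Omega\to\mathbb{R}\text{ is Lipschitz and }\|F(\cdot,du(\cdot))\|_{L^\infty(\Omega)}\leq 1\big\}.$$ Pointwise Lipschitz constant: $$\operatorname{Lip}_{\delta_F}u(x)=\limsup_{y\to x}\frac{|u(y)-u(x)|}{\delta_F(x,y)}.$$ *)

(* Defs.v *)
From HB Require Import structures.
From mathcomp Require Import all_boot all_order all_algebra.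
From mathcomp Require Import all_classical all_reals all_analysis measurable_realfun.

Set Implicit Arguments.
Unset Strict Implicit.
Unset Printing Implicit Defensive.

Import Order.TTheory GRing.Theory Num.Theory.
Import numFieldNormedType.Exports.

Local Open Scope classical_set_scope.
Local Open Scope ring_scope.

(* R^n with its Borel sigma-algebra; convertible to 'rV[R]_n. *)
Notation borel_rV R n := (g_sigma_algebraType (@open 'rV[R]_n)).

Section borel_rV_lemmas.
Variable R : realType.

Lemma measurable_coord n (i : 'I_n) :
  measurable_fun [set: borel_rV R n] (fun x : borel_rV R n => x ord0 i : R).
Proof.
move=> mT; apply: (measurability _ (RGenOInfty.measurableE R)) => //.
move=> _ [_ [a ->] <-]; apply: sub_sigma_algebra; rewrite setTI.
apply: (@open_comp 'rV[R]_n R); last exact: interval_open.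
by move=> x _; exact: coord_continuous.
Qed.

Lemma open_rV_bigcup_rat n (A : set 'rV[R]_n) : open A ->
  A = \bigcup_(p : 'rV[rat]_n * rat)
    [set y | (forall z : 'rV[R]_n,
        (forall i, `|ratr (p.1 ord0 i) - z ord0 i| < ratr p.2) -> A z) /\
      forall i, `|ratr (p.1 ord0 i) - y ord0 i| < ratr p.2].
Proof.
move=> oA; apply/seteqP; split => [y Ay|y [p _ [pA /pA]]//].
have /nbhs_ballP[e /= e0 yeA] := open_nbhs_nbhs (conj oA Ay).
have e20 : 0 < e / 2 by rewrite divr_gt0.
have [r /itvP rI] := rat_in_itvoo e20.
have r0 : 0 < (ratr r : R) by rewrite rI.
have /choice[q qP] : forall i, exists x : rat, `|ratr x - y ord0 i| < ratr r.
  move=> i; have /rat_in_itvoo[x /itvP xI] :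
      y ord0 i - ratr r < y ord0 i + ratr r by rewrite ltrD2l gtrN.
  by exists x; rewrite ltr_distl !xI.
exists (\row_i q i, r) => //=; split => [z zq|i]; last by rewrite mxE.
apply: yeA; split => // i j; move: (zq j); rewrite mxE => zqj.
rewrite (ord1 i) /ball/= (splitr e).
rewrite (le_lt_trans (ler_distD (ratr (q j)) _ _))// ltrD//.
  by rewrite distrC (lt_trans (qP j))// rI.
by rewrite (lt_trans zqj)// rI.
Qed.

Lemma measurable_fun_rV d (T : measurableType d) n (f : T -> borel_rV R n) :
  (forall i, measurable_fun setT (fun x => f x ord0 i : R)) ->
  measurable_fun setT f.
Proof.
move=> mf mT.
apply: (@measurability _ _ T (borel_rV R n) setT f (@open 'rV[R]_n)) => //.
move=> _ [A oA <-]; rewrite setTI (open_rV_bigcup_rat oA) preimage_bigcup.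
apply: countable_bigcupT_measurable => // p.
have [pA|pA] := pselect (forall z : 'rV[R]_n,
  (forall i, `|ratr (p.1 ord0 i) - z ord0 i| < ratr p.2) -> A z); last first.
  by rewrite (_ : _ @^-1` _ = set0)//; apply/seteqP; split => // x [].
rewrite (_ : _ @^-1` _ = \bigcap_(i in [set: 'I_n])
    ((fun x => f x ord0 i : R) @^-1` ball (ratr (p.1 ord0 i) : R) (ratr p.2))).
  apply: fin_bigcap_measurable => // i _.
  by rewrite -[X in measurable X]setTI; apply: mf => //; exact: measurable_ball.
by apply/seteqP; split => x /= => [[_ xp] i _|xp]; [exact: xp|split=> // i; exact: xp].
Qed.

End borel_rV_lemmas.

Section lebesgue_rV.
Variable R : realType.

Definition consrV n (p : borel_rV R n * measurableTypeR R) : borel_rV R n.+1 :=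
  row_mx (p.2%:M : 'rV[R]_1) p.1.

Lemma consrV_ord0 n p : @consrV n p ord0 ord0 = p.2.
Proof.
have -> : ord0 = lshift n (ord0 : 'I_1) :> 'I_(1 + n) by exact/val_inj.
by rewrite /consrV (@row_mxEl _ 1 1 n) mxE eqxx mulr1n.
Qed.

Lemma consrV_lift n p (j : 'I_n) :
  @consrV n p ord0 (lift ord0 j) = (p.1 : 'rV[R]_n) ord0 j.
Proof. by rewrite /consrV -rshift1 (@row_mxEr _ 1 1 n). Qed.

Lemma measurable_consrV n : measurable_fun setT (@consrV n).
Proof.
apply: measurable_fun_rV => i; have [j ->|->] := unliftP ord0 i.
  rewrite (_ : (fun x => _) =
    (fun x : borel_rV R n => x ord0 j : R) \o fst); last first.
    by apply/funext => p; rewrite consrV_lift.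
  by apply: (measurableT_comp (measurable_coord j)); exact: measurable_fst.
rewrite (_ : (fun x => _) = snd); first exact: measurable_snd.
by apply/funext => p; rewrite consrV_ord0.
Qed.

Section product_step.
Variables (n : nat) (mu : {measure set (borel_rV R n) -> \bar R}).

Definition cons_lebesgue : set (borel_rV R n.+1) -> \bar R :=
  pushforward (mu \x @lebesgue_measure R)%E (@consrV n).

Let cons_lebesgue0 : cons_lebesgue set0 = 0%E.
Proof. by rewrite /cons_lebesgue /pushforward preimage_set0 measure0. Qed.

Let cons_lebesgue_ge0 A : (0 <= cons_lebesgue A)%E.
Proof. by apply: integral_ge0 => x _; exact: measure_ge0. Qed.

Let cons_lebesgue_sigma_additive : semi_sigma_additive cons_lebesgue.
Proof.
have mc B : measurable B -> measurable (@consrV n @^-1` B).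
  by move=> mB; rewrite -[X in measurable X]setTI; exact: measurable_consrV.
move=> B mB tB mUB; rewrite /cons_lebesgue /pushforward preimage_bigcup.
apply: measure_semi_sigma_additive => [i|/=|].
- exact: mc.
- apply/trivIsetP => i j _ _ ij; rewrite -preimage_setI.
  by move/trivIsetP : tB => -> //; rewrite preimage_set0.
- by rewrite -preimage_bigcup; exact: mc.
Qed.

HB.instance Definition _ := isMeasure.Build _ _ _ cons_lebesgue
  cons_lebesgue0 cons_lebesgue_ge0 cons_lebesgue_sigma_additive.

End product_step.

(* The n-fold product of the Lebesgue measure of R, see lebesgue_rV_box. *)
Fixpoint lebesgue_rV n : {measure set (borel_rV R n) -> \bar R} :=
  match n with
  | 0 => @dirac _ (borel_rV R 0) (0 : 'rV[R]_0) R
  | m.+1 => cons_lebesgue (lebesgue_rV m)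
  end.

End lebesgue_rV.

Lemma lebesgue_rV_box (R : realType) n (A : 'I_n -> set R) :
  (forall i, measurable (A i)) ->
  lebesgue_rV R n [set x | forall i, A i (x ord0 i)] =
  (\prod_(i < n) @lebesgue_measure R (A i))%E.
Proof.
elim: n A => [A _|n ih A mA].
  rewrite big_ord0 /= diracE mem_set//=; by case.
rewrite big_ord_recl muleC -ih => [|i]; last exact: mA.
have mS : measurable
    [set x : borel_rV R n | forall i, A (lift ord0 i) (x ord0 i)].
  rewrite [X in measurable X](_ : _ = \bigcap_(i in [set: 'I_n])
      ((fun x : borel_rV R n => x ord0 i : R) @^-1` A (lift ord0 i))).
    apply: fin_bigcap_measurable => // i _.
    by rewrite -[X in measurable X]setTI; apply: measurable_coord.
  by apply/seteqP; split => x /= xA i; [move=> _|]; exact: xA.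
rewrite -[RHS](@product_measure1E _ _ (borel_rV R n) (measurableTypeR R) R
  (lebesgue_rV R n) (@lebesgue_measure R) _ _ mS (mA ord0)).
congr product_measure1; apply/seteqP; split => [x xA|x [xA x0] i].
  split => [i|]; rewrite /=.
    by have := xA (lift ord0 i); rewrite consrV_lift.
  by have := xA ord0; rewrite consrV_ord0.
by have [j ->|->] := unliftP ord0 i; rewrite ?consrV_lift ?consrV_ord0.
Qed.

Section finsler.
Variables (R : realType) (n : nat).
Implicit Types (Omega : set 'rV[R]_n) (F : 'rV[R]_n -> 'rV[R]_n -> R).
Implicit Types (u w : 'rV[R]_n -> R) (x y v : 'rV[R]_n).

Definition is_domain Omega := open Omega /\ connected Omega.

Definition ae_in Omega (P : 'rV[R]_n -> Prop) :=
  {ae lebesgue_rV R n, forall x, Omega x -> P x}.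

(* The norm `|v| provided by the library on 'rV[R]_n is the sup norm. *)
Definition enorm v : R := Num.sqrt (\sum_i v ord0 i ^+ 2).

(* Functions on Omega are represented by total functions; only their values on
   Omega are ever used. *)
Record finsler_structure Omega F : Prop := {
  finsler_ge0 : forall x v, Omega x -> 0 <= F x v;
  finsler_measurable : forall v,
    measurable_fun (Omega : set (borel_rV R n)) (F ^~ v);
  finsler_continuous : ae_in Omega (fun x => continuous (F x));
  finsler_gt0 : forall v, v != 0 -> ae_in Omega (fun x => 0 < F x v);
  finsler_homogeneous : ae_in Omega (fun x =>
    forall (l : R) v, F x (l *: v) = `|l| * F x v)
}.

Record admissible Omega F : Prop := {
  admissible_finsler :> finsler_structure Omega F;
  admissible_convex : ae_in Omega (fun x => convex_function setT (F x));
  admissible_bounds : exists lambda : 'rV[R]_n -> R,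
    [/\ {within Omega, continuous lambda},
        forall x, Omega x -> 1 <= lambda x
      & ae_in Omega (fun x => forall v,
          (lambda x)^-1 * enorm v <= F x v <= lambda x * enorm v)]
}.

(* x^' is the filter of punctured neighbourhoods of x; including y = x in the
   limsup would not change the inequality. *)
Definition usc_at Omega w x :=
  (limf_esup (EFin \o w) (within Omega x^') <= (w x)%:E)%E.

Definition weak_usc Omega w := ae_in Omega (usc_at Omega w).

Definition finsler_weak_usc Omega F := forall v, weak_usc Omega (F ^~ v).

Definition lipschitz_in Omega u := exists L : R,
  forall x y, Omega x -> Omega y -> `|u x - u y| <= L * enorm (x - y).

(* The vector representing the differential 'd u x : R^n -> R for the standard
   inner product; unspecified where u is not differentiable. *)
Definition gradient u x : 'rV[R]_n := \row_i 'd u x (delta_mx ord0 i).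

Definition Linfty_norm Omega (g : 'rV[R]_n -> R) : \bar R :=
  Lnorm (lebesgue_rV R n) +oo%E ((EFin \o g) \_ Omega).

Definition intrinsic_dist Omega F x y : \bar R :=
  ereal_sup [set (u x - u y)%:E | u in [set u | lipschitz_in Omega u /\
    (Linfty_norm Omega (fun z => F z (gradient u z)) <= 1)%E]].

(* Division in \bar R; for delta := intrinsic_dist Omega F with F admissible, the
   denominator is positive and finite for distinct x and y in a domain Omega. *)
Definition pointwise_lip Omega (delta : 'rV[R]_n -> 'rV[R]_n -> \bar R) u x
    : \bar R :=
  limf_esup (fun y => `|u y - u x|%:E / delta x y)%E (within Omega x^').

End finsler.

(* Main.v *)
Require Import Defs.
From HB Require Import structures.
From mathcomp Require Import all_boot all_order all_algebra.
From mathcomp Require Import all_classical all_reals all_analysis measurable_realfun ess_sup_inf.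
From mathcomp Require Import ring lra zify.

Set Implicit Arguments.
Unset Strict Implicit.
Unset Printing Implicit Defensive.

Import Order.TTheory GRing.Theory Num.Theory.
Import numFieldNormedType.Exports.

Local Open Scope classical_set_scope.
Local Open Scope ring_scope.

(** Write D_x for the norm dual to the norm F x. To first order at a good
    point x the intrinsic distance to x + h is D_x h, and the pointwise
    Lipschitz constant of u is therefore the supremum of |<p, h>| / D_x h with
    p the gradient of u, which is F x p by biduality.

    Distances are not too small. If F is upper semicontinuous at x, then
    F z <= (1 + e) F x for all z near x, uniformly in the vector variable
    (usc_uniform), so the cone D_x (z - x), truncated at a small height and
    divided by 1 + e, is a competitor in the supremum defining the distance
    (cone_test_fun). Hence the distance is at least D_x h / (1 + e), which
    bounds the pointwise Lipschitz constant of u from above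
    (pointwise_lip_le).

    Distances are not too large. Fix w and let A be the set of points z at
    which w belongs to the dual unit ball of F z. A competitor has slope at
    most 1 along w at almost every point of A, and bounded slope elsewhere; if x
    is a density point of A on the line through x with direction w, its
    increment from x to x + t w is at most t (1 + o(1)). Since competitors are
    equi-Lipschitz near x, countably many of them suffice, and for almost every
    x in A the distance from x to x + t w is at most t (1 + o(1))
    (slow_direction_ae). If k < F x p, separation provides a rational w in the
    dual unit ball of F x with <w, p> > k (norm_separation_rat); approaching x
    along w shows that the pointwise Lipschitz constant is at least k
    (pointwise_lip_ge).

    Both halves rest on three facts. On the line,
    a Lipschitz function is the integral of its derivative, because its Stieltjes
    measure is dominated by Lebesgue measure (lipschitz_density). In R^n, null
    sets and density points can be studied on the lines of a given direction,
    because Lebesgue measure is translation invariant (line_fubini). Finally,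
    Rademacher's theorem (rademacher) follows from both by adding one
    coordinate direction at a time at points of density of the sets where the
    function is almost affine along the directions already treated. The
    norm |v| of a vector is its sup norm throughout. *)

(** * Lipschitz functions of one real variable *)

Section lipschitz_real_line.
Variable R : realType.
Local Notation leb := (@lebesgue_measure R).

Lemma stieltjes_ocitv (f : cumulative R R) (a b : R) : a <= b ->
  lebesgue_stieltjes_measure f `]a, b] = (f b - f a)%:E.
Proof.
move=> ab; rewrite /lebesgue_stieltjes_measure /measure_extension.
by rewrite measurable_mu_extE/= ?wlength_itv_bnd//; exact: is_ocitv.
Qed.

Lemma lipschitz_continuous (V : normedModType R) (L : R) (g : V -> R) :
  (forall s t, `|g s - g t| <= L * `|s - t|) -> continuous g.
Proof.
move=> gL x; apply/cvgrPdist_le => e e0.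
have L1 : 0 < `|L| + 1 by rewrite ltr_wpDl.
apply/nbhs_ballP; exists (e / (`|L| + 1)); rewrite /= ?divr_gt0// => y.
rewrite -ball_normE/= ltr_pdivlMr// => xy.
rewrite (le_trans (gL _ _))// (le_trans _ (ltW xy))// mulrC ler_wpM2l//.
by rewrite (le_trans (ler_norm _))// lerDl.
Qed.

Section density.
Variables (g : R -> R) (L : R).
Hypotheses (L0 : 0 < L) (gL : forall s t, `|g s - g t| <= L * `|s - t|).

Definition lip_up s := (g s + L * s) / (2 * L).
Definition lip_dn s := (L * s - g s) / (2 * L).

Let lip_up_nd : {homo lip_up : x y / x <= y}.
Proof.
move=> x y xy; rewrite /lip_up ler_pM2r ?invr_gt0 ?mulr_gt0//.
have := gL x y; rewrite distrC [X in _ * X]distrC (ger0_norm (_ : 0 <= y - x)) ?subr_ge0//.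
by rewrite ler_norml => /andP[h _]; lra.
Qed.

Let lip_dn_nd : {homo lip_dn : x y / x <= y}.
Proof.
move=> x y xy; rewrite /lip_dn ler_pM2r ?invr_gt0 ?mulr_gt0//.
have := gL x y; rewrite distrC [X in _ * X]distrC (ger0_norm (_ : 0 <= y - x)) ?subr_ge0//.
by rewrite ler_norml => /andP[_ h]; lra.
Qed.

Let lip_up_rc : right_continuous lip_up.
Proof.
apply: right_continuousW => x; apply: cvgM; last exact: cvg_cst.
by apply: cvgD; [exact: lipschitz_continuous gL x|apply: cvgM; [exact: cvg_cst|exact: cvg_id]].
Qed.

Let lip_dn_rc : right_continuous lip_dn.
Proof.
apply: right_continuousW => x; apply: cvgM; last exact: cvg_cst.
by apply: cvgB; [apply: cvgM; [exact: cvg_cst|exact: cvg_id]|exact: lipschitz_continuous gL x].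
Qed.

HB.instance Definition _ := isCumulative.Build R _ R lip_up lip_up_nd lip_up_rc.
HB.instance Definition _ := isCumulative.Build R _ R lip_dn lip_dn_nd lip_dn_rc.

Local Notation nu1 := (lebesgue_stieltjes_measure (lip_up : cumulative R R)).
Local Notation nu2 := (lebesgue_stieltjes_measure (lip_dn : cumulative R R)).

(** g is split through two nondecreasing functions: lip_up and lip_dn are
    continuous and add up to the identity, so the two Stieltjes measures are
    pieces of Lebesgue measure; in particular the first one has a density. *)
Lemma stieltjes_lip_split A : measurable A -> leb A = (nu1 A + nu2 A)%E.
Proof.
move=> mA; rewrite -measure_addE; apply: lebesgue_measure_unique mA.
move=> _ [[a b] _ <-]; rewrite [fst _]/= [snd _]/=.
have [ab|ba] := leP a b; last first.
  by rewrite set_itv_ge -?leNgt ?measure0// bnd_simp ltW.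
transitivity (nu1 `]a, b] + nu2 `]a, b])%E; last by rewrite -measure_addE.
have -> : nu1 `]a, b] = (lip_up b - lip_up a)%:E by exact: stieltjes_ocitv.
have -> : nu2 `]a, b] = (lip_dn b - lip_dn a)%:E by exact: stieltjes_ocitv.
rewrite -EFinD lebesgue_measure_itv/= lte_fin.
rewrite lt_neqAle ab andbT; have [->|_] := eqVneq a b; first by rewrite !subrr addr0.
rewrite -EFinB /lip_up /lip_dn; congr EFin.
by field; rewrite gt_eqF.
Qed.

Lemma stieltjes_lip_dominated : nu1 `<< leb.
Proof.
move=> A A0 B mB BA; have := A0 B mB BA; rewrite stieltjes_lip_split// => /eqP.
by rewrite padde_eq0 ?measure_ge0// => /andP[/eqP].
Qed.

(** The fundamental theorem of calculus for Lipschitz functions. The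
    Radon-Nikodym density f of the Stieltjes measure of lip_up recovers lip_up
    by integration, and at each Lebesgue point of f the primitive has
    derivative f; solving lip_up = (g + L s) / 2L for g gives both claims. *)
Lemma lipschitz_density (a b : R) : a < b ->
  exists f : R -> R, [/\ measurable_fun setT f, forall x, 0 <= f x,
    (\int[leb]_(x in `]a, b]) (f x)%:E =
      ((g b - g a + L * (b - a)) / (2 * L))%:E)%E &
    {ae leb, forall x, x \in `]a, b[ ->
      is_derive x 1 g (2 * L * f x - L)}].
Proof.
move=> ab.
have mab : measurable (`]a, b] : set (measurableTypeR R)) by exact: measurable_itv.
have nuab : (nu1 `]a, b] < +oo)%E.
  have -> : nu1 `]a, b] = (lip_up b - lip_up a)%:E by exact/stieltjes_ocitv/ltW.
  exact: ltey.
have dom : mfrestr mab nuab `<< leb.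
  move=> A A0 B mB BA; rewrite /mfrestr /mrestr.
  have h := @stieltjes_lip_dominated A A0.
  apply: (h (B `&` `]a, b]) (measurableI _ _ mB mab)).
  by apply: subset_trans BA; exact: subIsetl.
have [f [f0 ffin fint fE]] := radon_nikodym_sigma_finite dom.
have fK x : (fine (f x))%:E = f x by rewrite fineK.
have fineE : EFin \o (fine \o f) = f by apply/funext.
have lE y : a <= y -> y <= b ->
    (\int[leb]_(x in `]a, y]) f x = (lip_up y - lip_up a)%:E)%E.
  move=> ay yb; have my : measurable (`]a, y] : set (measurableTypeR R)) by exact: measurable_itv.
  rewrite -(fE _ my).
  transitivity (nu1 (`]a, y] `&` `]a, b])); first by [].
  rewrite setIidl; last by apply: subset_itvl; rewrite bnd_simp.
  exact: stieltjes_ocitv.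
have mf : measurable_fun setT (fine \o f).
  by apply/measurable_EFinP; rewrite fineE; exact: measurable_int fint.
exists (fine \o f); split => //.
- by move=> x; rewrite /= fine_ge0.
- under eq_integral do rewrite fK.
  rewrite lE ?(ltW ab)// /lip_up; congr EFin; field.
  by rewrite gt_eqF.
have fint' : leb.-integrable setT (EFin \o (fine \o f)).
  by rewrite fineE.
have : {ae leb, forall x, lebesgue_pt (fine \o f) x}.
  by apply: lebesgue_differentiation; apply: open_integrable_locally => //; exact: openT.
apply: filterS; first exact: (ae_filter_ringOfSetsType leb).
move=> x fx; rewrite in_itv/= => /andP[ax xb].
have fintb : leb.-integrable `]a, b] (EFin \o (fine \o f)).
  by apply: integrableS fint'.
have [] := @FTC1_lebesgue_pt R (fine \o f) (BRight a) x b xb fintb ax fx.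
set G := fun y => _.
move=> dG G'.
have GE : \forall y \near x, g y = 2 * L * G y + (g a - L * (y - a)).
  have : \forall y \near x, y \in `]a, b[ by apply: near_in_itvoo; rewrite in_itv/= ax.
  apply: filterS => y; rewrite in_itv/= => /andP[ay yb].
  rewrite /G /Rintegral; under eq_integral do rewrite /= fK.
  rewrite lE ?ltW//= /lip_up; field.
  by rewrite gt_eqF.
have isG : is_derive x 1 G (fine (f x)).
  by split; [exact: dG|rewrite -derive1E; exact: G'].
have : is_derive x 1 (fun y => 2 * L * G y + (g a - L * (y - a))) (2 * L * fine (f x) - L).
  by apply: is_derive_eq; rewrite /GRing.scale/=; ring.
move=> isg.
apply: near_eq_is_derive isg; by apply: filterS GE => y ->.
Qed.

End density.
End lipschitz_real_line.

Section lipschitz_consequences.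
Variable R : realType.
Local Notation leb := (@lebesgue_measure R).

Lemma lipschitz_ae_derivable (g : R -> R) (L : R) :
  (forall s t, `|g s - g t| <= L * `|s - t|) ->
  {ae leb, forall x, derivable g x 1}.
Proof.
move=> gL; pose L' := `|L| + 1.
have L'0 : 0 < L' by rewrite ltr_wpDl.
have gL' s t : `|g s - g t| <= L' * `|s - t|.
  by rewrite (le_trans (gL _ _))// ler_wpM2r// (le_trans (ler_norm _))// lerDl.
have step (k : nat) :
    leb.-negligible [set x | ~ (x \in `](- k.+1%:R), k.+1%:R[ -> derivable g x 1)].
  have [|f [_ _ _]] := @lipschitz_density R g L' L'0 gL' (- k.+1%:R) k.+1%:R.
    by rewrite gtrN.
  apply: negligibleS => x /= h1 h2; apply: h1 => /h2 h.
  by case: h.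
apply: negligibleS (negligible_bigcup step) => x /= ndx.
exists (Num.bound `|x|) => //= h; apply: ndx; apply: h.
by rewrite in_itv/= -ltr_norml (lt_trans (archi_boundP (normr_ge0 _)))// ltr_nat.
Qed.

(** The mean value inequality in the form used along lines: an almost
    everywhere bound on the derivative which degrades from K to K + M off a
    set A only costs M times the measure of the complement of A. *)
Lemma lipschitz_increment_le (g : R -> R) (L : R) (a b K M : R) (A : set R) :
  (forall s t, `|g s - g t| <= L * `|s - t|) -> a < b -> 0 <= K -> 0 <= M ->
  measurable A ->
  {ae leb, forall x, x \in `]a, b[ -> forall d, is_derive x 1 g d ->
     d <= K + M * (x \notin A)%:R} ->
  ((g b - g a)%:E <= (K * (b - a))%:E + M%:E * leb (`]a, b] `\` A))%E.
Proof.
move=> gL ab K0 M0 mA gKM; pose L' := `|L| + 1.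
have L'0 : 0 < L' by rewrite ltr_wpDl.
have gL' s t : `|g s - g t| <= L' * `|s - t|.
  by rewrite (le_trans (gL _ _))// ler_wpM2r// (le_trans (ler_norm _))// lerDl.
have [f [mf f0 fE fd]] := @lipschitz_density R g L' L'0 gL' a b ab.
have mab : measurable (`]a, b] : set R) by exact: measurable_itv.
have mnA : measurable (~` A) by exact: measurableC.
pose h x := (2 * L')^-1 * ((K + L') + M * \1_(~` A) x).
have h0 x : 0 <= h x.
  by rewrite mulr_ge0 ?invr_ge0 ?addr_ge0 ?mulr_ge0// ltW.
have mh : measurable_fun setT h.
  apply: measurable_funM => //; apply: measurable_funD => //.
  by apply: measurable_funM => //; exact: measurable_indic.
have : (\int[leb]_(x in `]a, b]) (f x)%:E <= \int[leb]_(x in `]a, b]) (h x)%:E)%E.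
  apply: ae_ge0_le_integral => //.
  - by move=> x _; rewrite lee_fin.
  - by apply/measurable_EFinP; exact: measurable_funTS.
  - by move=> x _; rewrite lee_fin.
  - by apply/measurable_EFinP; exact: measurable_funTS.
  (* the density is integrated over ]a, b], the slopes are bounded on ]a, b[ *)
  have nb : {ae leb, forall x, x != b}.
    exists [set b]; split => //; first exact: lebesgue_measure_set1.
    by move=> x /= /negP; rewrite negbK => /eqP.
  move: gKM fd nb; apply: filterS3; first exact: (ae_filter_ringOfSetsType leb).
  move=> x hx1 hx2 xb; rewrite /= in_itv/= => /andP[ax xb'].
  have xab : x \in `]a, b[ by rewrite in_itv/= ax lt_neqAle xb.
  have := hx1 xab _ (hx2 xab); rewrite lee_fin /h => hd.
  rewrite mulrC ler_pdivlMr ?mulr_gt0//.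
  have -> : \1_(~` A) x = (x \notin A)%:R :> R.
    by rewrite indicE in_setC.
  by lra.
have hE x : (h x)%:E = ((2 * L')^-1%:E * ((K + L')%:E + M%:E * (\1_(~` A) x)%:E))%E.
  by rewrite /h EFinM [X in (_ * X)%E]EFinD [X in (_ * (_ + X))%E]EFinM.
under [in leRHS]eq_integral do rewrite hE.
rewrite fE.
have mi : measurable_fun `]a, b] (fun x => (\1_(~` A) x)%:E : \bar R).
  by apply/measurable_EFinP; apply: measurable_funTS; exact: measurable_indic.
rewrite ge0_integralZl//; first last.
- by rewrite lee_fin invr_ge0 mulr_ge0// ltW.
- by move=> x _; rewrite adde_ge0 ?mule_ge0 ?lee_fin ?addr_ge0// ltW.
- by apply: emeasurable_funD => //; apply: measurable_funeM.
rewrite ge0_integralD//; first last.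
- exact: measurable_funeM.
- by move=> x _; rewrite mule_ge0 ?lee_fin.
- by move=> x _; rewrite lee_fin addr_ge0// ltW.
rewrite ge0_integralZl// integral_cst//= integral_indic// lebesgue_measure_itv/=.
rewrite lte_fin ab setIC -setDE.
have fm : leb (`]a, b] `\` A) \is a fin_num.
  rewrite ge0_fin_numE// (@le_lt_trans _ _ (leb `]a, b]))//.
    by rewrite le_measure ?inE//; first [exact: measurableD|exact: subDsetl].
  by rewrite lebesgue_measure_itv/= lte_fin ab -EFinB ltey.
rewrite -(fineK fm) -?EFinB; set m := fine _.
change (((g b - g a + L' * (b - a)) / (2 * L'))%:E <= ((2 * L')^-1 * ((K + L') * (b - a) + M * m))%:E -> (g b - g a)%:E <= (K * (b - a) + M * m)%:E)%E.
rewrite !lee_fin.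
rewrite ler_pdivrMr ?mulr_gt0//.
rewrite mulrAC mulVf ?mulf_neq0 ?pnatr_eq0 ?gt_eqF// mul1r.
by move=> H; lra.
Qed.

(** The density theorem restated through the complement: only the smallness
    of the missing part of a ball is ever needed. *)
Lemma lebesgue_density_defect (A : set R) : measurable A ->
  {ae leb, forall x, A x -> forall e, 0 < e ->
    \forall r \near 0^'+, (leb (ball x r `\` A) <= (e * r)%:E)%E}.
Proof.
move=> mA; have := lebesgue_density mA.
apply: filterS; first exact: (ae_filter_ringOfSetsType leb).
move=> x + Ax e e0; rewrite indicE mem_set// => /fine_cvgP[+ /cvgrPdist_le].
move=> h1 /(_ (e / 2)); rewrite divr_gt0// => /(_ isT) h2.
near=> r.
have r0 : 0 < r by [].
have mb : measurable (ball x r) by exact: measurable_ball.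
have lb : leb (ball x r) = (2 * r)%:E.
  by rewrite lebesgue_measure_ball ?ltW// mulr_natl.
have fin B : measurable B -> B `<=` ball x r -> leb B \is a fin_num.
  move=> mB Br; rewrite ge0_fin_numE// (@le_lt_trans _ _ (leb (ball x r)))//.
    by rewrite le_measure ?inE.
  by rewrite lb ltey.
have fD : leb (ball x r `\` A) \is a fin_num.
  by apply: fin; [exact: measurableD|exact: subDsetl].
have fI : leb (A `&` ball x r) \is a fin_num.
  by apply: fin; [exact: measurableI|exact: subIsetr].
have : `|1 - fine (leb (A `&` ball x r) * (leb (ball x r))^-1)%E| <= e / 2.
  by near: r.
have : leb (ball x r) = (leb (A `&` ball x r) + leb (ball x r `\` A))%E.
  rewrite -measureU; [|exact: measurableI|exact: measurableD|].
    congr (leb _); apply/seteqP; split => y /=; last by move=> [[]|[]].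
    by have [Ay|nAy] := pselect (A y); [left|right].
  by apply/seteqP; split => y //= [[Ay _] [_]].
rewrite lb -(fineK fD) -(fineK fI) inver mulf_eq0 pnatr_eq0/= gt_eqF//.
rewrite -EFinD -EFinM/= => -[E] /ler_normlP[_ h].
rewrite lee_fin.
have : 1 - e / 2 <= fine (leb (A `&` ball x r)) / (2 * r) by lra.
rewrite ler_pdivlMr ?mulr_gt0// => h'.
by nra.
Unshelve. all: by end_near. Qed.

End lipschitz_consequences.

(** * Lebesgue measure and lines *)

Section lebesgue_rV_sigma_finite.
Variable R : realType.
Local Notation leb := (@lebesgue_measure R).

(** A copy of the Lebesgue measure that carries the sigma-finite structure
    required by the theorems on product measures. *)
Definition lebN n : set (borel_rV R n) -> \bar R := lebesgue_rV R n.

HB.instance Definition _ n := Measure.on (@lebN n).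

Definition cube n (k : nat) : set (borel_rV R n) :=
  [set x | forall i, `[- k%:R, k%:R]%classic (x ord0 i)].

Lemma measurable_cube n k : measurable (@cube n k).
Proof.
rewrite [X in measurable X](_ : _ = \bigcap_(i in [set: 'I_n])
    ((fun x : borel_rV R n => x ord0 i : R) @^-1` `[- k%:R, k%:R]%classic)).
  apply: fin_bigcap_measurable => // i _.
  by rewrite -[X in measurable X]setTI; apply: measurable_coord.
by apply/seteqP; split => x /= xA i; [move=> _|]; exact: xA.
Qed.

Lemma lebN_cube_lty n k : (lebN (@cube n k) < +oo)%E.
Proof.
have mI (i : 'I_n) : measurable (`[- k%:R, k%:R]%classic : set R) by exact: measurable_itv.
have h := @lebesgue_rV_box R n (fun=> `[- k%:R, k%:R]%classic) mI.
rewrite [X in (X < _)%E]h -ge0_fin_numE; last by apply: prode_ge0.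
apply: prode_fin_num => i _; rewrite lebesgue_measure_itv/=.
by case: ifP => _; rewrite -?EFinB.
Qed.

Lemma lebN_sigma_finite n : sigma_finite setT (@lebN n).
Proof.
exists (@cube n); last by move=> k; split; [exact: measurable_cube|exact: lebN_cube_lty].
apply/esym; rewrite -subTset => x _.
exists (Num.bound (\sum_i `|x ord0 i|)) => //= i.
rewrite /= in_itv/= -ler_norml ltW// (le_lt_trans _ (archi_boundP _))//.
  by rewrite (bigD1 i)//= lerDl sumr_ge0.
by rewrite sumr_ge0.
Qed.

HB.instance Definition _ n :=
  @Measure_isSigmaFinite.Build _ _ _ (@lebN n) (@lebN_sigma_finite n).

End lebesgue_rV_sigma_finite.

Section translation.
Variable R : realType.
Local Notation leb := (@lebesgue_measure R).

Lemma lebesgue_measure_shift (c : R) (A : set R) : measurable A ->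
  leb [set t | A (t + c)] = leb A.
Proof.
move=> mA.
have mT : measurable_fun setT (fun t : measurableTypeR R => t + c : measurableTypeR R).
  by apply: (@measurable_funD _ _ R setT id (cst c)).
have h := @lebesgue_measure_unique R (pushforward leb (fun t => t + c : measurableTypeR R)).
rewrite (h mT _ _ mA)// => _ [[a b] _ <-]; rewrite [fst _]/= [snd _]/=.
transitivity (leb `]a - c, b - c]%classic).
  by rewrite !lebesgue_measure_itv/= !lte_fin ltrD2r -!EFinB opprD addrACA subrr addr0.
congr (leb _).
by apply/seteqP; split => t; rewrite /= !in_itv/= ltrBlDr lerBrDr.
Qed.

Lemma measurable_rV_shift n (v : 'rV[R]_n) :
  measurable_fun setT (fun x : borel_rV R n => (x : 'rV[R]_n) + v : borel_rV R n).
Proof.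
apply: measurable_fun_rV => i.
rewrite (_ : (fun x => _) = (fun x : borel_rV R n => x ord0 i + v ord0 i : R)).
  by apply: measurable_funD => //; exact: measurable_coord.
by apply/funext => x; rewrite mxE.
Qed.

Lemma consrV_shift n (x : 'rV[R]_n) (t : R) (v : 'rV[R]_n.+1) :
  (consrV (x, t) : 'rV_n.+1) + v =
  consrV (x + \row_j v ord0 (lift ord0 j), t + v ord0 ord0).
Proof.
apply/rowP => i; rewrite mxE; have [j ->|->] := unliftP ord0 i.
  by rewrite !consrV_lift/= !mxE.
by rewrite !consrV_ord0.
Qed.

(** By induction on the dimension: slicing along the first coordinate reduces
    the claim to translation invariance on the line for each slice, and to the
    induction hypothesis for the measure of the slices. *)
Lemma lebN_shift n (v : 'rV[R]_n) (A : set (borel_rV R n)) : measurable A ->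
  lebN [set x | A ((x : 'rV[R]_n) + v)] = lebN A.
Proof.
elim: n v A => [v A _|n ih v A mA].
  congr (lebN _); apply/funext => x; by rewrite /= (thinmx0 (_ + v)) (thinmx0 x).
pose v' : 'rV[R]_n := \row_j v ord0 (lift ord0 j).
pose phi (x : borel_rV R n) := leb (xsection (@consrV R n @^-1` A) x).
have mc : measurable (@consrV R n @^-1` A).
  by rewrite -[X in measurable X]setTI; exact: measurable_consrV.
have E1 : lebN A = (\int[lebN (n := n)]_x phi x)%E by [].
have E2 : lebN [set x | A ((x : 'rV[R]_n.+1) + v)] =
    (\int[lebN (n := n)]_x phi ((x : 'rV[R]_n) + v')%R)%E.
  apply: eq_integral => x _; rewrite /= /phi.
  transitivity (leb [set t | xsection (@consrV R n @^-1` A) ((x : 'rV[R]_n) + v') (t + v ord0 ord0)]); last first.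
    by apply: lebesgue_measure_shift; exact: measurable_xsection.
  congr (leb _); apply/seteqP; split => t /=;
    by rewrite /xsection/= !inE/= consrV_shift.
rewrite E2 {}E1.
have mphi : measurable_fun setT phi by exact: measurable_fun_xsection.
transitivity (\int[pushforward (@lebN R n)
    (fun x => ((x : 'rV[R]_n) + v')%R : borel_rV R n)]_x phi x)%E.
  by rewrite (ge0_integral_pushforward (measurable_rV_shift v')).
by apply: eq_measure_integral => [|mB B mB' _]; [exact: measurable_rV_shift|rewrite -[RHS](ih v' B mB')].
Qed.

End translation.

Section lines.
Variables (R : realType) (n : nat).
Local Notation leb := (@lebesgue_measure R).
Local Notation mu := (@lebN R n).
Implicit Types (x v w : 'rV[R]_n) (A N : set (borel_rV R n)).

(** The section of A by the line through x with direction w, parametrized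
    from x. *)
Definition line_trace A w x : set R := [set s | A (x + s *: w)].

Lemma measurable_line_map w : measurable_fun setT
  (fun p : borel_rV R n * measurableTypeR R => (p.1 : 'rV[R]_n) + p.2 *: w : borel_rV R n).
Proof.
apply: measurable_fun_rV => i.
rewrite (_ : (fun p => _) = (fun p : borel_rV R n * measurableTypeR R =>
    (p.1 : 'rV[R]_n) ord0 i + p.2 * w ord0 i : R)); last first.
  by apply/funext => p; rewrite !mxE.
apply: measurable_funD.
  by apply: (measurableT_comp (measurable_coord i)); exact: measurable_fst.
by apply: measurable_funM => //; exact: measurable_snd.
Qed.

Lemma measurable_line_trace A w x : measurable A -> measurable (line_trace A w x).
Proof.
move=> mA; rewrite -[X in measurable X]setTI.
apply: (measurableT_comp (@measurable_line_map w) (@measurable_pair1 _ _ (borel_rV R n) (measurableTypeR R) x)) => //.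
Qed.

Let lineset A w : set (borel_rV R n * measurableTypeR R) :=
  [set p | A ((p.1 : 'rV[R]_n) + p.2 *: w)].

Let mlineset A w : measurable A -> measurable (lineset A w).
Proof.
by move=> mA; rewrite -[X in measurable X]setTI; exact: measurable_line_map.
Qed.

Lemma measurable_line_measure A w : measurable A ->
  measurable_fun setT (fun x : borel_rV R n => leb (line_trace A w x)).
Proof.
move=> mA; have := @measurable_fun_xsection _ _ _ _ _ leb _ (mlineset w mA).
congr measurable_fun; apply/funext => x /=; congr (leb _).
by apply/seteqP; split => s; rewrite /xsection/= inE.
Qed.

(** Translation invariance replaces a change of coordinates adapted to w:
    integrating the lengths of the sections over all base points x counts, for
    each parameter s, the translate of A by - s w. *)
Lemma line_fubini A w : measurable A ->
  (\int[mu]_x leb (line_trace A w x) = \int[leb]_s mu A)%E.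
Proof.
move=> mA; have := @indic_fubini_tonelli _ _ _ _ R mu leb _ (mlineset w mA).
rewrite (@indic_fubini_tonelli_FE _ _ _ _ R leb _ (mlineset w mA)).
rewrite (@indic_fubini_tonelli_GE _ _ _ _ R mu _ (mlineset w mA)) => h.
transitivity (\int[mu]_x (leb \o xsection (lineset A w)) x)%E.
  apply: eq_integral => x _ /=; congr (leb _).
  by apply/seteqP; split => s; rewrite /xsection/= inE.
rewrite h; apply: eq_integral => s _ /=; rewrite -(lebN_shift (s *: w) mA).
congr (mu _); apply/seteqP; split => x; by rewrite /ysection/= inE.
Qed.

Lemma null_ae_line N w : measurable N -> mu N = 0%E ->
  {ae mu, forall x, leb (line_trace N w x) = 0%E}.
Proof.
move=> mN N0; have := line_fubini w mN; rewrite N0 integral0 => h.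
have h' : (\int[mu]_x `|leb (line_trace N w x)| = 0)%E.
  by rewrite -h; apply: eq_integral => z _; rewrite gee0_abs.
have := (ae_eq_integral_abs mu measurableT (measurable_line_measure w mN)).1 h'.
apply: filterS.
by move=> z /(_ I).
Qed.

(** In line_fubini the right-hand side integrates the constant mu A over the
    whole line, so it vanishes only if mu A does. *)
Lemma null_of_null_lines A w : measurable A ->
  (forall x, leb (line_trace A w x) = 0%E) -> mu A = 0%E.
Proof.
move=> mA A0; have := line_fubini w mA.
under eq_integral do rewrite A0.
rewrite integral0 integral_cst// => /esym/eqP.
have lT : leb setT = +oo%E by rewrite -set_itvNyy lebesgue_measure_itv.
rewrite [X in (_ * X)%E == _](_ : _ = +oo%E)//.
by rewrite mule_eq0 orbF => /eqP.
Qed.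

End lines.

#[global] Instance ae_lebN_filter (R : realType) n :
  Filter (nbhs (almost_everywhere (@lebN R n))).
Proof. exact: ae_filter_ringOfSetsType. Qed.

Section line_density.
Variables (R : realType) (n : nat).
Local Notation leb := (@lebesgue_measure R).
Local Notation mu := (@lebN R n).
Implicit Types (w : 'rV[R]_n) (A N : set (borel_rV R n)).

(** A point x is a density point of A on its line in direction w when this
    length is o(r). *)
Definition line_defect A w (x : 'rV[R]_n) (r : R) : \bar R :=
  leb (ball 0 r `\` line_trace A w x).

Lemma measurable_line_defect A w r : measurable A ->
  measurable_fun setT (fun x : borel_rV R n => line_defect A w x r).
Proof.
move=> mA.
pose D : set (borel_rV R n * measurableTypeR R) :=
  (setT `*` ball 0 r) `\` [set p | A ((p.1 : 'rV[R]_n) + p.2 *: w)].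
have mD : measurable D.
  apply: measurableD; first by apply: measurableX => //; exact: measurable_ball.
  by rewrite -[X in measurable X]setTI; exact: measurable_line_map.
have := @measurable_fun_xsection _ _ _ _ _ leb _ mD.
congr measurable_fun; apply/funext => x /=; congr (leb _).
by apply/seteqP; split => s; rewrite /xsection/= inE /D/= => -[]; [move=> [_]|]; split.
Qed.

Lemma line_defect_shift A w z s r : measurable A ->
  line_defect A w (z + s *: w) r = leb (ball s r `\` line_trace A w z).
Proof.
move=> mA; rewrite -(lebesgue_measure_shift s); last first.
  by apply: measurableD; [exact: measurable_ball|exact: measurable_line_trace].
congr (leb _); apply/seteqP; split => t;
  by rewrite /line_trace/= /ball/= sub0r normrN opprD addrA addrAC subrr sub0r normrN
    scalerDl -addrA (addrC (s *: w)).
Qed.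

Lemma line_defect_le A w x r r' : measurable A -> r <= r' ->
  (line_defect A w x r <= line_defect A w x r')%E.
Proof.
move=> mA rr'; apply: le_measure; rewrite ?inE.
- by apply: measurableD; [exact: measurable_ball|exact: measurable_line_trace].
- by apply: measurableD; [exact: measurable_ball|exact: measurable_line_trace].
by apply: setSD; exact: le_ball.
Qed.

(** The one-dimensional density theorem on each line, integrated with
    null_of_null_lines. The exceptional set is Borel because it is expressed by the
    countably many radii 1/(j+1), which control all small radii up to a
    factor 2. *)
Lemma line_density A w : measurable A ->
  {ae mu, forall x, A x -> forall e, 0 < e ->
    \forall r \near 0^'+, (line_defect A w x r <= (e * r)%:E)%E}.
Proof.
move=> mA.
pose good k j : set (borel_rV R n) :=
  [set x | (line_defect A w x j.+1%:R^-1 <= (k.+1%:R^-1 * j.+1%:R^-1)%:E)%E].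
pose bad : set (borel_rV R n) :=
  A `&` \bigcup_k ~` \bigcup_J \bigcap_(j in [set j | (J <= j)%N]) good k j.
have mgood k j : measurable (good k j).
  rewrite -[X in measurable X]setTI.
  apply: emeasurable_fun_le => //; exact: measurable_line_defect.
have mbad : measurable bad.
  apply: measurableI => //; apply: bigcup_measurable => k _; apply: measurableC.
  by apply: bigcup_measurable => J _; apply: bigcap_measurableType.
have bad0 : mu bad = 0%E.
  apply: (@null_of_null_lines _ _ bad w mbad) => z.
  have mb : measurable (line_trace bad w z) by exact: measurable_line_trace.
  apply: measure_negligible => //.
  have := lebesgue_density_defect (measurable_line_trace w z mA).
  apply: negligibleS => s [As [k _ nk]] /= H; apply: nk.
  have [|e /= e0 He] := H As k.+1%:R^-1; first by rewrite invr_gt0.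
  have [J _ HJ] : \forall J \near \oo, J.+1%:R^-1 < e :> R by apply: near_infty_natSinv_lt (PosNum e0).
  exists J => // j /= Jj; rewrite /good/= line_defect_shift//.
  by apply: He => /=; rewrite ?sub0r ?normrN ?gtr0_norm ?HJ.
exists bad; split => // x /=.
apply: contra_notP => nbad Ax e e0.
have [k ke] : exists k : nat, k.+1%:R^-1 < e / 2.
  have [J _ HJ] : \forall J \near \oo, J.+1%:R^-1 < e / 2 :> R.
    have e20 : 0 < e / 2 by rewrite divr_gt0.
    exact: near_infty_natSinv_lt (PosNum e20).
  by exists J; apply: HJ => /=.
have [J _ HJ] : (\bigcup_J \bigcap_(j in [set j | (J <= j)%N]) good k j) x.
  by apply: contrapT => nJ; apply: nbad; split => //; exists k.
near=> r.
have r0 : 0 < r by [].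
(* 1/(j+2) < r <= 1/(j+1), so passing from r to 1/(j+1) at most doubles it *)
pose j := (Num.truncn r^-1).-1.
have r1 : 1 <= r^-1.
  by rewrite -invr1 lef_pV2 ?posrE//; near: r; exact: nbhs_right_le.
have jE : j.+1 = Num.truncn r^-1.
  by rewrite /j prednK// truncn_gt0.
have /andP[h1 h2] := truncn_itv (ltW (lt_le_trans ltr01 r1)).
have Jj : (J <= j)%N.
  rewrite -ltnS jE truncn_ge_nat; last by rewrite (le_trans _ r1).
  rewrite -[leLHS]invrK lef_pV2 ?posrE ?invr_gt0//; near: r.
  by apply: nbhs_right_le; rewrite invr_gt0.
have rj : r <= j.+1%:R^-1 by rewrite -[leLHS]invrK lef_pV2 ?posrE ?invr_gt0// jE.
apply: le_trans (line_defect_le w x mA rj) _.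
apply: le_trans (HJ j Jj) _; rewrite lee_fin.
have rj2 : j.+1%:R^-1 <= 2 * r.
  rewrite -[leRHS]invrK lef_pV2 ?posrE ?invr_gt0 ?mulr_gt0// invfM.
  rewrite mulrC ler_pdivrMr//.
  apply: le_trans (ltW h2) _; rewrite -jE -natrM ler_nat. lia.
rewrite (le_trans (ler_pM _ _ (ltW ke) rj2)) ?invr_ge0//.
by rewrite mulrA divfK.
Unshelve. all: by end_near. Qed.

End line_density.

(** Nonempty open sets contain boxes, which have positive measure. *)
Lemma ae_meets_open (R : realType) n (P : 'rV[R]_n -> Prop) (U : set 'rV[R]_n) (x : 'rV[R]_n) :
  {ae lebN (n:=n), forall y, P y} -> open U -> U x -> exists y, U y /\ P y.
Proof.
move=> [N [mN N0 PN]] oU Ux; apply: contrapT => nex.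
have [e /= e0 xeU] : nbhs_ball x U by apply/nbhs_ballP; exact: open_nbhs_nbhs.
have mI (i : 'I_n) : measurable (`](x ord0 i - e), (x ord0 i + e)[%classic : set R).
  exact: measurable_itv.
have h := @lebesgue_rV_box R n (fun i => `](x ord0 i - e), (x ord0 i + e)[%classic) mI.
have : (0 < lebN N)%E.
  apply: (@lt_le_trans _ _ (lebN [set y : borel_rV R n |
     forall i, `](x ord0 i - e), (x ord0 i + e)[%classic (y ord0 i)])).
    rewrite [X in (_ < X)%E]h; apply: (big_ind (fun z => 0 < z)%E) => //.
      by move=> ? ? ? ?; exact: mule_gt0.
    move=> i _; rewrite lebesgue_measure_itv/= lte_fin.
    rewrite ltrD2l gtrN// -EFinB lte_fin; lra.
  apply: le_measure; rewrite ?inE//.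
    rewrite [X in measurable X](_ : _ = \bigcap_(i in [set: 'I_n])
        ((fun y : borel_rV R n => y ord0 i : R) @^-1` `](x ord0 i - e), (x ord0 i + e)[%classic)).
      apply: fin_bigcap_measurable => // i _.
      by rewrite -[X in measurable X]setTI; apply: measurable_coord.
    by apply/seteqP; split => y /= xA i; [move=> _|]; exact: xA.
  move=> y /= yb; apply: PN => /= Py; apply: nex; exists y; split=> //.
  apply: xeU; split => // i j; rewrite (ord1 i).
  have := yb j; rewrite /= in_itv/= /ball/= -ltr_distl distrC. by [].
by rewrite N0 ltxx.
Qed.

Lemma ae_forall_countable (R : realType) n (T : countType) (P : T -> 'rV[R]_n -> Prop) :
  (forall t, {ae lebN (n:=n), forall x, P t x}) ->
  {ae lebN (n:=n), forall x, forall t, P t x}.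
Proof.
move=> aeP.
pose bad (k : nat) : set (borel_rV R n) :=
  if unpickle k is Some t then ~` [set x | P t x] else set0.
have nbad k : (@lebN R n).-negligible (bad k).
  by rewrite /bad; case: unpickle => [t|]; [exact: aeP|exact: negligible_set0].
apply: negligibleS (negligible_bigcup nbad) => x /= /existsNP[t nt].
by exists (pickle t) => //; rewrite /bad pickleK.
Qed.

(** * Gradients *)

Section dot_product.
Variables (R : realType) (n : nat).
Implicit Types (x y v w a h p : 'rV[R]_n).

Definition dot v w : R := \sum_i v ord0 i * w ord0 i.

Lemma dotC v w : dot v w = dot w v.
Proof. by apply: eq_bigr => i _; rewrite mulrC. Qed.

Lemma dotDl v v' w : dot (v + v') w = dot v w + dot v' w.
Proof. by rewrite -big_split; apply: eq_bigr => i _; rewrite mxE mulrDl. Qed.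

Lemma dotZl (c : R) v w : dot (c *: v) w = c * dot v w.
Proof. by rewrite [RHS]mulr_sumr; apply: eq_bigr => i _; rewrite mxE mulrA. Qed.

Lemma dotDr v w w' : dot v (w + w') = dot v w + dot v w'.
Proof. by rewrite dotC dotDl !(dotC v). Qed.

Lemma dotZr (c : R) v w : dot v (c *: w) = c * dot v w.
Proof. by rewrite dotC dotZl (dotC v). Qed.

Lemma dotNl v w : dot (- v) w = - dot v w.
Proof. by rewrite -scaleN1r dotZl mulN1r. Qed.

Lemma dotNr v w : dot v (- w) = - dot v w.
Proof. by rewrite -scaleN1r dotZr mulN1r. Qed.

Lemma dotBl v v' w : dot (v - v') w = dot v w - dot v' w.
Proof. by rewrite dotDl dotNl. Qed.

Lemma dotBr v w w' : dot v (w - w') = dot v w - dot v w'.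
Proof. by rewrite dotDr dotNr. Qed.

Lemma dot0l w : dot 0 w = 0.
Proof. by rewrite /dot big1// => i _; rewrite mxE mul0r. Qed.

Lemma dot0r w : dot w 0 = 0.
Proof. by rewrite dotC dot0l. Qed.

Lemma dot_delta v i : dot v (delta_mx ord0 i) = v ord0 i.
Proof.
rewrite /dot (bigD1 i)//= mxE !eqxx mulr1 big1 ?addr0// => j ji.
by rewrite mxE (negbTE ji) andbF mulr0.
Qed.

Lemma ler_rV_coord x i : `|x ord0 i| <= `|x|.
Proof. by rewrite [leRHS]/Num.Def.normr/= mx_normrE; apply/bigmax_geP; right; exists (ord0, i). Qed.

Lemma rV_norm_le x (c : R) : 0 <= c -> (forall i, `|x ord0 i| <= c) -> `|x| <= c.
Proof.
move=> c0 xc; rewrite [leLHS]/Num.Def.normr/= mx_normrE; apply: bigmax_le => // -[i j] _ /=.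
by rewrite (ord1 i).
Qed.

Lemma rV_norm_lt x (c : R) : 0 < c -> (forall i, `|x ord0 i| < c) -> `|x| < c.
Proof.
move=> c0 xc; rewrite [ltLHS]/Num.Def.normr/= mx_normrE; apply: bigmax_lt => // -[i j] _ /=.
by rewrite (ord1 i).
Qed.

(** The factor n appears because the norm is the sup norm. *)
Lemma dot_le v w : `|dot v w| <= n%:R * `|v| * `|w|.
Proof.
rewrite (le_trans (ler_norm_sum _ _ _))//.
rewrite (le_trans (ler_sum _ (fun i _ => (_ : _ <= `|v| * `|w|))))//.
  by move=> i; rewrite normrM ler_pM// ler_rV_coord.
by rewrite sumr_const card_ord -[leLHS]mulr_natl mulrA.
Qed.

Lemma dot_is_linear v : linear (dot v).
Proof. by move=> c w w'; rewrite dotDr dotZr. Qed.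

Lemma dot_continuous v : continuous (dot v).
Proof.
apply: (@lipschitz_continuous R _ (n%:R * `|v|)) => w w'.
by rewrite -dotBr; exact: dot_le.
Qed.

End dot_product.

Section gradients.
Variables (R : realType) (n : nat).
Implicit Types (x y v w a h p : 'rV[R]_n) (f : 'rV[R]_n -> R).

(** The differential of f at x in epsilon-delta form, represented by a vector
    for the dot product. *)
Definition first_order f x p := forall e, 0 < e -> exists2 d, 0 < d &
  forall h, `|h| < d -> `|f (x + h) - f x - dot p h| <= e * `|h|.

Lemma diff_dot f x h : differentiable f x -> 'd f x h = dot (gradient f x) h.
Proof.
move=> df; rewrite {1}(row_sum_delta h) linear_sum; apply: eq_bigr => i _.
by rewrite linearZ/= mxE mulrC.
Qed.

Lemma differentiable_first_order f x :
  differentiable f x -> first_order f x (gradient f x).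
Proof.
move=> df e e0; have /diff_locallyP[_ /eqaddoP/(_ e e0)] := df.
move=> /nbhs_ballP[d /= d0 H]; exists d => // h hd.
have := H h; rewrite -ball_normE/= sub0r normrN => /(_ hd).
rewrite !fctE /= /shift/= -diff_dot// (addrC x) opprD addrA.
by [].
Qed.

Lemma first_order_differentiable f x p :
  first_order f x p -> differentiable f x /\ gradient f x = p.
Proof.
move=> fp.
pose L : {linear 'rV[R]_n -> R^o} := HB.pack (dot p)
  (GRing.isLinear.Build R 'rV[R]_n R^o _ (dot p) (dot_is_linear p)).
have cL : continuous L by exact: dot_continuous.
have E e : 0 < e ->
    \forall h \near nbhs (0 : 'rV[R]_n), `|f (h + x) - (f x + dot p h)| <= e * `|h|.
  move=> e0; have [d d0 H] := fp e e0.
  apply/nbhs_ballP; exists d => // h; rewrite -ball_normE/= sub0r normrN => hd.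
  by have := H h hd; rewrite (addrC x) opprD addrA.
have dE : 'd f x = dot p :> (_ -> _).
  by apply: (@diff_unique R _ R^o f L x cL); apply/eqaddoP => e /E.
split; first by apply/diff_locallyP; rewrite dE; split=> //; apply/eqaddoP => e /E.
by apply/rowP => i; rewrite mxE dE /= dot_delta.
Qed.

Lemma is_derive_line f x w (s : R) : differentiable f (x + s *: w) ->
  is_derive s 1 (fun t : R => f (x + t *: w)) (dot (gradient f (x + s *: w)) w).
Proof.
move=> df.
have E : (fun h : R => h^-1 *: (f (x + (h *: 1 + s) *: w) - f (x + s *: w))) =
   (fun h : R => h^-1 *: (f (h *: w + (x + s *: w)) - f (x + s *: w))).
  apply/funext => h; congr (_ *: (f _ - _)).
  by rewrite scalerDl addrCA [h *: 1]mulr1.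
have d1 : derivable f (x + s *: w) w by exact: diff_derivable.
split; first by rewrite /derivable /= E.
by rewrite -diff_dot// -deriveE// /derive /= E.
Qed.

(** The gradient depends on the germ only: this transfers gradients between a
    function on an open set and an extension of it. *)
Lemma gradient_near f g x : (\forall y \near x, f y = g y) ->
  differentiable f x -> differentiable g x /\ gradient g x = gradient f x.
Proof.
move=> /nbhs_ballP[r /= r0 fg] df; apply: first_order_differentiable => e e0.
have [d d0 H] := differentiable_first_order df e0.
exists (Num.min d r); first by rewrite lt_min d0.
move=> h; rewrite lt_min => /andP[hd hr].
rewrite -!fg; [exact: H|exact: ballxx|].
by rewrite -ball_normE/= opprD addNKr normrN.
Qed.

End gradients.

(** * Rademacher's theorem *)

Lemma derivable_first_order (R : realType) (g : R -> R) (s : R) : derivable g s 1 ->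
  exists b, forall e, 0 < e -> exists2 d, 0 < d &
    forall t, `|t| < d -> `|g (s + t) - g s - t * b| <= e * `|t|.
Proof.
move=> dg; exists ('d g s 1) => e e0.
have /derivable1_diffP/diff_locallyP[_ /eqaddoP/(_ e e0)] := dg.
move=> /nbhs_ballP[d /= d0 H]; exists d => // t td.
have := H t; rewrite /ball/= sub0r normrN => /(_ td).
rewrite !fctE /= /shift/= (addrC s) opprD addrA.
by rewrite (_ : 'd g s t = t * 'd g s 1)// -[in LHS](mulr1 t) linearZ.
Qed.

Section rademacher.
Variables (R : realType) (n : nat).
Local Notation leb := (@lebesgue_measure R).
Local Notation mu := (@lebN R n).
Implicit Types (x y v w h : 'rV[R]_n) (V : set 'rV[R]_n) (f : 'rV[R]_n -> R).

(** Near a point of density of A, every interval of relative size eta meets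
    A; otherwise the interval would be a defect proportional to its distance
    from the point. *)
Lemma density_hits (A : set (borel_rV R n)) w x (eta : R) : measurable A ->
  (forall e, 0 < e -> \forall r \near 0^'+, (line_defect A w x r <= (e * r)%:E)%E) ->
  0 < eta -> exists2 d, 0 < d &
  forall t, 0 < `|t| < d -> exists t', `|t - t'| < eta * `|t| /\ A (x + t' *: w).
Proof.
move=> mA dA eta0.
have c0 : 0 < eta / (1 + eta) by rewrite divr_gt0// addr_gt0.
have [d /= d0 H] := dA _ c0.
exists (d / (1 + eta)); first by rewrite divr_gt0// addr_gt0.
move=> t /andP[t0 td]; apply: contrapT => nt.
have r0 : 0 < (1 + eta) * `|t| by rewrite mulr_gt0// addr_gt0.
have h2 : (line_defect A w x ((1 + eta) * `|t|) <=
    (eta / (1 + eta) * ((1 + eta) * `|t|))%:E)%E.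
  apply: H => //; rewrite /ball/= sub0r normrN gtr0_norm//.
  by rewrite mulrC -ltr_pdivlMr// addr_gt0.
have : (leb (ball t (eta * `|t|)) <= line_defect A w x ((1 + eta) * `|t|))%E.
  apply: le_measure; rewrite ?inE; first exact: measurable_ball.
    by apply: measurableD; [exact: measurable_ball|exact: measurable_line_trace].
  move=> s; rewrite /ball/= => ts; split.
    rewrite sub0r normrN -(subrK t s) (le_lt_trans (ler_normD _ _))//.
    by rewrite mulrDl mul1r addrC ltrD2l distrC.
  by move=> As; apply: nt; exists s.
rewrite lebesgue_measure_ball; last by rewrite mulr_ge0// ltW.
move=> h1.
have := le_trans h1 h2; rewrite lee_fin.
rewrite mulrA divfK ?gt_eqF ?addr_gt0//.
by rewrite -subr_ge0 mulr2n opprD addrA subrr sub0r oppr_ge0 leNgt mulr_gt0.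
Qed.

(** The points where f is affine up to e along V at scale d. The slope is
    rational so that diff_along is a countable combination of such sets, which
    are closed when f is continuous. *)
Definition affine_on f V (a : 'rV[rat]_n) (e d : R) : set 'rV[R]_n :=
  [set x | forall h, V h -> `|h| < d ->
    `|f (x + h) - f x - dot (map_mx ratr a) h| <= e * `|h|].

(** Differentiability of f in the directions of V, without naming the
    differential: for each precision some rational slope does. *)
Definition diff_along f V : set 'rV[R]_n :=
  [set x | forall m : nat, exists (a : 'rV[rat]_n) (j : nat),
    affine_on f V a m.+1%:R^-1 j.+1%:R^-1 x].

Variables (f : 'rV[R]_n -> R) (L : R).
Hypothesis fL : forall x y, `|f x - f y| <= L * `|x - y|.

Lemma affine_on_closed V a e d : closed (affine_on f V a e d).
Proof.
rewrite (_ : affine_on f V a e d = \bigcap_(h in [set h | V h /\ `|h| < d])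
    (fun x => `|f (x + h) - f x - dot (map_mx ratr a) h|) @^-1` [set r | r <= e * `|h|]).
  apply: closed_bigI => h _; apply: closed_comp; last exact: closed_le.
  move=> x _.
  apply: (@lipschitz_continuous R _ (2 * `|L|) (fun x => `|f (x + h) - f x - dot (map_mx ratr a) h|)) => s t.
  rewrite (le_trans (ler_dist_dist _ _))//; set c := dot _ _.
  have -> : f (s + h) - f s - c - (f (t + h) - f t - c) =
      (f (s + h) - f (t + h)) + (f t - f s) by ring.
  rewrite (le_trans (ler_normD _ _))// mulrDl mul1r mulrDl lerD//.
    rewrite (le_trans (fL _ _))// opprD addrACA subrr addr0 ler_wpM2r//.
    exact: ler_norm.
  by rewrite (le_trans (fL _ _))// distrC ler_wpM2r// ler_norm.
apply/seteqP; split => x xA h; first by move=> [Vh hd]; exact: xA.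
by move=> Vh hd; apply: xA.
Qed.

Lemma measurable_affine_on V a e d :
  measurable (affine_on f V a e d : set (borel_rV R n)).
Proof.
rewrite -[X in measurable X]setCK; apply: measurableC; apply: sub_sigma_algebra.
exact/closed_openC/affine_on_closed.
Qed.

Lemma measurable_diff_along V : measurable (diff_along f V : set (borel_rV R n)).
Proof.
rewrite [X in measurable X](_ : _ = \bigcap_m \bigcup_(p : 'rV[rat]_n * nat)
   (affine_on f V p.1 m.+1%:R^-1 p.2.+1%:R^-1 : set (borel_rV R n))).
  apply: bigcap_measurableType => m _; apply: countable_bigcupT_measurable => // p.
  exact: measurable_affine_on.
apply/seteqP; split => x xA m.
  by move=> _; have [a [j h]] := xA m; exists (a, j).
by have [[a j] _ h] := xA m I; exists a, j.
Qed.

Definition axis (i : 'I_n) : set 'rV[R]_n := range (fun t : R => t *: delta_mx ord0 i).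

Lemma normr_scale_delta (i : 'I_n) (t : R) : `|t *: delta_mx ord0 i : 'rV[R]_n| = `|t|.
Proof.
apply/eqP; rewrite eq_le; apply/andP; split.
  apply: rV_norm_le => // j; rewrite !mxE eqxx/=; case: eqP => _.
    by rewrite mulr1.
  by rewrite mulr0 normr0.
by have := ler_rV_coord (t *: delta_mx ord0 i : 'rV[R]_n) i; rewrite !mxE !eqxx mulr1.
Qed.

(** One-dimensional Lipschitz functions are differentiable almost everywhere;
    apply this on every line parallel to an axis. *)
Lemma diff_along_axis (i : 'I_n) : {ae mu, forall x, diff_along f (axis i) x}.
Proof.
pose e : 'rV[R]_n := delta_mx ord0 i.
exists (~` diff_along f (axis i)); split => //.
  by apply: measurableC; exact: measurable_diff_along.
have mD : measurable (~` diff_along f (axis i) : set (borel_rV R n)).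
  by apply: measurableC; exact: measurable_diff_along.
apply: (@null_of_null_lines _ _ _ e mD) => z.
apply: measure_negligible; first exact: measurable_line_trace.
pose g (s : R) := f (z + s *: e).
have gL s t : `|g s - g t| <= L * `|s - t|.
  rewrite (le_trans (fL _ _))//.
  by rewrite opprD addrACA subrr add0r -scalerBl normr_scale_delta.
have := lipschitz_ae_derivable gL.
apply: negligibleS => s ns dg; apply: ns => m.
have m0 : 0 < m.+1%:R^-1 / 2 :> R by rewrite divr_gt0// invr_gt0.
have [b /(_ _ m0)[d d0 H]] := derivable_first_order dg.
have [|q] := @rat_in_itvoo R (b - m.+1%:R^-1 / 2) (b + m.+1%:R^-1 / 2).
  by rewrite ltrD2l gtrN.
rewrite in_itv/= -ltr_distl => qb.
have [J _ HJ] : \forall J \near \oo, J.+1%:R^-1 < d :> R.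
  exact: near_infty_natSinv_lt (PosNum d0).
exists (q *: delta_mx ord0 i), J => _ [t _ <-]; rewrite normr_scale_delta => tJ.
have tE : dot (map_mx ratr (q *: delta_mx ord0 i)) (t *: delta_mx ord0 i : 'rV[R]_n) = t * ratr q.
  by rewrite dotZr dot_delta !mxE !eqxx mulr1.
have := H t (lt_trans tJ (HJ J (leqnn J))).
rewrite tE /g scalerDl addrA => h.
rewrite (_ : _ - _ - _ = f (z + s *: e + t *: e) - f (z + s *: e) - t * b + t * (b - ratr q)); last by ring.
rewrite (le_trans (ler_normD _ _))// [in leRHS](splitr m.+1%:R^-1) mulrDl lerD//.
by rewrite normrM mulrC ler_wpM2r// distrC ltW.
Qed.

Definition head_space (k : nat) : set 'rV[R]_n :=
  [set h | forall i : 'I_n, (k <= i)%N -> h ord0 i = 0].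

(** The heart of Rademacher's theorem. Let A be the set of points at which f
    is affine, up to eps, both along the first i coordinates and along the
    i-th axis, with fixed slopes and scales. At a point x of A which is a
    density point of A on the line parallel to the axis, the increment of f
    from x to x + h, with h = h' + t e, is computed through a point x + t' e
    of A with t' very close to t: move along the axis from x to x + t' e, then
    by h' from the point x + t' e, at which the slope along the first
    coordinates is the same as at x. *)
Lemma diff_along_head_step (i : 'I_n) :
  {ae mu, forall x, diff_along f (head_space i) x} ->
  {ae mu, forall x, diff_along f (head_space i.+1) x}.
Proof.
move=> head_i.
pose e : 'rV[R]_n := delta_mx ord0 i.
pose A (p : nat * 'rV[rat]_n * nat * 'rV[rat]_n * nat) : set (borel_rV R n) :=
  let: (m, a, j, b, k) := p in
  affine_on f (head_space i) a m.+1%:R^-1 j.+1%:R^-1 `&`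
  affine_on f (axis i) b m.+1%:R^-1 k.+1%:R^-1.
have mA p : measurable (A p).
  by case: p => [[[[m a] j] b] k]; apply: measurableI; exact: measurable_affine_on.
have dens : {ae mu, forall x, forall p, A p x -> forall c, 0 < c ->
    \forall r \near 0^'+, (line_defect (A p) e x r <= (c * r)%:E)%E}.
  by apply: ae_forall_countable => p; exact: line_density (mA p).
move: head_i (diff_along_axis i) dens; apply: filterS3 => x xh xa xd m.
have [a [j xaj]] := xh (4 * m + 3)%N; have [b [k xbk]] := xa (4 * m + 3)%N.
(* four errors of size eps add up, whence the precision 4 (m + 1) *)
set eps := (4 * m + 3).+1%:R^-1 in xaj xbk.
have eps0 : 0 < eps by rewrite invr_gt0.
have epsE : m.+1%:R^-1 = 4 * eps.
  rewrite /eps (_ : (4 * m + 3).+1 = (4 * m.+1)%N); last by lia.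
  by rewrite natrM invfM mulrA divff ?mul1r// pnatr_eq0.
pose bi : R := ratr (b ord0 i).
pose eta : R := Num.min 1 (eps / (1 + `|L| + `|bi|)).
have c0 : 0 < 1 + `|L| + `|bi| by rewrite -addrA ltr_pwDl// addr_ge0.
have eta0 : 0 < eta by rewrite lt_min ltr01 divr_gt0.
have eta1 : eta <= 1 by rewrite ge_min lexx.
have etaL : eta * (`|L| + `|bi|) <= eps.
  rewrite (@le_trans _ _ (eta * (1 + `|L| + `|bi|)))//.
    by rewrite ler_wpM2l ?(ltW eta0)// -addrA lerDr.
  by rewrite -ler_pdivlMr// ge_min lexx orbT.
pose p := ((4 * m + 3)%N, a, j, b, k).
have [d d0 hits] := density_hits (mA p) (xd p (conj xaj xbk)) eta0.
have [J _ HJ] : \forall J \near \oo,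
    J.+1%:R^-1 < Num.min (d / 2) (Num.min (j.+1%:R^-1 / 2) (k.+1%:R^-1 / 2)) :> R.
  have dd : 0 < Num.min (d / 2) (Num.min (j.+1%:R^-1 / 2) (k.+1%:R^-1 / 2)).
    by rewrite !lt_min !divr_gt0// ?invr_gt0.
  exact: near_infty_natSinv_lt (PosNum dd).
pose a' : 'rV[rat]_n := \row_l if (l < i)%N then a ord0 l else b ord0 l.
exists a', J => h hV hJ.
pose t := h ord0 i; pose h' := h - t *: e.
have h'V : head_space i h'.
  move=> l il; rewrite !mxE eqxx/=; have [->|li] := eqVneq l i.
    by rewrite mulr1 subrr.
  rewrite mulr0 subr0; apply: hV.
  by rewrite ltn_neqAle eq_sym il andbT.
have hE : h = h' + t *: e by rewrite subrK.
have th : `|t| <= `|h| by exact: ler_rV_coord.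
have h'h : `|h'| <= `|h|.
  apply: rV_norm_le => // l; rewrite !mxE eqxx/=; have [->|li] := eqVneq l i.
    by rewrite mulr1 subrr normr0.
  by rewrite mulr0 subr0; exact: ler_rV_coord.
have := lt_trans hJ (HJ J (leqnn J)); rewrite !lt_min => /and3P[hd hj hk].
have dE : dot (map_mx ratr a') h = dot (map_mx ratr a) h' + t * bi.
  rewrite {1}hE dotDr dotZr dot_delta !mxE ltnn; congr (_ + _).
  apply: eq_bigr => l _; rewrite !mxE; case: ifPn => // li.
  by have := h'V l; rewrite !mxE leqNgt => /(_ li) ->; rewrite !mulr0.
have [t' [tt' [xa' xb']]] : exists t', `|t - t'| <= eta * `|t| /\ A p (x + t' *: e).
  have [t0|t0] := eqVneq t 0.
    by exists 0; rewrite t0 subrr normr0 mulr0 lexx scale0r addr0.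
  have [|t' [h1 h2]] := hits t.
    by rewrite normr_gt0 t0/= (le_lt_trans th)// (lt_trans hd)// ltr_pdivrMr// ltr_pMr// ltr1n.
  by exists t'; rewrite ltW.
have t'h : `|t'| <= 2 * `|h|.
  rewrite -(subrK t t') (le_trans (ler_normD _ _))// distrC mulrDl mul1r lerD//.
  rewrite (le_trans tt')// (le_trans _ th)//.
  by rewrite ler_piMl.
have E1 : `|f (x + h) - f (x + t' *: e + h')| <= `|L| * (eta * `|h|).
  rewrite (le_trans (fL _ _))// (le_trans (ler_wpM2r _ (ler_norm L)))// ler_wpM2l//.
  rewrite {1}hE (_ : _ - _ = (t - t') *: e).
    rewrite normr_scale_delta (le_trans tt')// ler_wpM2l ?(ltW eta0)//.
  by apply/rowP => l; rewrite !mxE; ring.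
have j0 : 0 < j.+1%:R^-1 :> R by rewrite invr_gt0.
have E2 : `|f (x + t' *: e + h') - f (x + t' *: e) - dot (map_mx ratr a) h'| <= eps * `|h|.
  rewrite (le_trans (xa' h' h'V _))//; last by rewrite ler_wpM2l// ltW.
  by rewrite (le_lt_trans h'h)// (lt_trans hj)// gtr_pMr// invf_lt1// ltr1n.
have E3 : `|f (x + t' *: e) - f x - t' * bi| <= 2 * eps * `|h|.
  have -> : t' * bi = dot (map_mx ratr b) (t' *: e) by rewrite dotZr dot_delta mxE.
  rewrite (le_trans (xbk _ _ _))//; first by exists t'.
    by rewrite normr_scale_delta (le_lt_trans t'h)// mulrC -ltr_pdivlMr.
  by rewrite normr_scale_delta -mulrA mulrCA ler_wpM2l// ltW.
have E4 : `|(t' - t) * bi| <= eta * `|h| * `|bi|.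
  rewrite normrM distrC ler_wpM2r// (le_trans tt')// ler_wpM2l// ltW//.
have -> : f (x + h) - f x - dot (map_mx ratr a') h =
  (f (x + h) - f (x + t' *: e + h')) +
  (f (x + t' *: e + h') - f (x + t' *: e) - dot (map_mx ratr a) h') +
  (f (x + t' *: e) - f x - t' * bi) + (t' - t) * bi by rewrite dE; ring.
rewrite (le_trans (ler_normD _ _))// (le_trans (lerD (ler_normD _ _) E4))//.
rewrite (le_trans (lerD (lerD (ler_normD _ _) E3) (lexx _)))//.
rewrite (le_trans (lerD (lerD (lerD E1 E2) (lexx _)) (lexx _)))// epsE.
have := ler_wpM2r (normr_ge0 h) etaL.
by move=> H; nra.
Qed.

(** The approximate slopes at two precisions differ by at most the sum of the
    precisions, so each coordinate of the gradient is the supremum of their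
    lower bounds. *)
Lemma diff_along_differentiable x :
  diff_along f (head_space n) x -> differentiable f x.
Proof.
move=> xd.
have /choice[a /choice[j aj]] := xd.
pose eps m : R := m.+1%:R^-1.
have hV h : head_space n h by move=> i; rewrite leqNgt ltn_ord.
pose c i m : R := ratr (a m ord0 i).
have cc i m m' : c i m - eps m <= c i m' + eps m'.
  rewrite lerBlDr -addrA -lerBlDl.
  pose s : R := Num.min (j m).+1%:R^-1 (j m').+1%:R^-1 / 2.
  have s0 : 0 < s by rewrite divr_gt0// lt_min !invr_gt0 !ltr0n.
  have s2 : s < Num.min (j m).+1%:R^-1 (j m').+1%:R^-1.
    by rewrite ltr_pdivrMr// ltr_pMr ?ltr1n// lt_min !invr_gt0 !ltr0n.
  move: s2; rewrite lt_min => /andP[sm sm'].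
  have := aj m (s *: delta_mx ord0 i) (hV _); rewrite normr_scale_delta gtr0_norm// => /(_ sm).
  have := aj m' (s *: delta_mx ord0 i) (hV _); rewrite normr_scale_delta gtr0_norm// => /(_ sm').
  rewrite !dotZr !dot_delta !mxE !ler_norml => /andP[h1 h2] /andP[h3 h4].
  rewrite -(ler_pM2l s0) -/(eps m) -/(eps m') -/(c i m) -/(c i m') in h1 h2 h3 h4 *.
  clearbody s c eps; nra.
pose E i : set R := [set r | exists m, r = c i m - eps m].
have Eub i m : ubound (E i) (c i m + eps m) by move=> _ [m' ->]; exact: cc.
have E0 i : E i !=set0 by exists (c i 0%N - eps 0%N); exists 0%N.
pose p : 'rV[R]_n := \row_i sup (E i).
have pc i m : `|p ord0 i - c i m| <= eps m.
  rewrite mxE ler_distl; apply/andP; split.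
    by apply: ub_le_sup; [exists (c i m + eps m); exact: Eub|exists m].
  by apply: ge_sup => //; exact: Eub.
suff : first_order f x p by move=> /first_order_differentiable[].
move=> e e0.
have n0 : 0 < n%:R + 1 :> R by rewrite ltr_wpDl.
have [m _ /(_ _ (leqnn _)) Hm] : \forall m \near \oo, m.+1%:R^-1 < e / (n%:R + 1) :> R.
  have en : 0 < e / (n%:R + 1) by rewrite divr_gt0.
  exact: near_infty_natSinv_lt (PosNum en).
exists (j m).+1%:R^-1; first by rewrite invr_gt0.
move=> h hj; have := aj m h (hV h) hj.
have : `|dot (map_mx ratr (a m) - p) h| <= n%:R * eps m * `|h|.
  rewrite (le_trans (dot_le _ _))// ler_wpM2r// ler_wpM2l//.
  apply: rV_norm_le; first by rewrite invr_ge0.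
  by move=> i; rewrite !mxE distrC; have := pc i m; rewrite mxE.
rewrite dotBl => h1 h2.
have -> : f (x + h) - f x - dot p h = (f (x + h) - f x - dot (map_mx ratr (a m)) h) +
  (dot (map_mx ratr (a m)) h - dot p h) by ring.
rewrite (le_trans (ler_normD _ _))// (le_trans (lerD h2 h1))// -mulrDl ler_wpM2r//.
move: Hm; rewrite ltr_pdivlMr// => /ltW; apply: le_trans.
by rewrite mulrDr mulr1 addrC (mulrC n%:R).
Qed.

(** The number of directions grows one coordinate at a time, starting from
    the trivial space. *)
Theorem rademacher : {ae mu, forall x, differentiable f x}.
Proof.
suff : forall k, (k <= n)%N -> {ae mu, forall x, diff_along f (head_space k) x}.
  move=> /(_ n (leqnn n)); apply: filterS => x.
  exact: diff_along_differentiable.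
elim=> [_|k ih kn]; last by apply: (diff_along_head_step (i := Ordinal kn)); exact/ih/ltnW.
apply: aeW => x m; exists 0, 0%N => h h0 _.
have -> : h = 0 by apply/rowP => i; rewrite h0// mxE.
by rewrite addr0 subrr dot0r subrr !normr0 mulr0.
Qed.

End rademacher.

(** * Lipschitz functions on an open set *)

Section mcshane.
Variables (R : realType) (n : nat).
Implicit Types (x y v : 'rV[R]_n) (Omega : set 'rV[R]_n) (u : 'rV[R]_n -> R).

Lemma enorm_ge_norm v : `|v| <= enorm v.
Proof.
apply: rV_norm_le; first exact: sqrtr_ge0.
move=> i; rewrite -sqrtr_sqr ler_wsqrtr// (bigD1 i)//= lerDl.
by apply: sumr_ge0 => j _; exact: sqr_ge0.
Qed.

Lemma enorm_le_norm v : enorm v <= n%:R * `|v|.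
Proof.
have n0 : 0 <= n%:R * `|v| by rewrite mulr_ge0.
rewrite -[leRHS]ger0_norm// -sqrtr_sqr ler_wsqrtr//.
rewrite (@le_trans _ _ (\sum_(i < n) `|v| ^+ 2))//.
  apply: ler_sum => i _; rewrite -[leLHS]ger0_norm ?sqr_ge0// normrX.
  by rewrite lerXn2r ?nnegrE// ler_rV_coord.
rewrite sumr_const card_ord -[leLHS]mulr_natl exprMn ler_wpM2r ?sqr_ge0//.
by rewrite -natrX ler_nat expnS expn1; case: (n) => // m; rewrite leq_pmulr.
Qed.

(** The extension f x = inf of u y + L |x - y| over y in Omega. The constant
    absorbs the comparison of the Euclidean norm with the sup norm. *)
Lemma mcshane_extension Omega u : lipschitz_in Omega u ->
  exists (L : R) (f : 'rV[R]_n -> R),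
    (forall x y, `|f x - f y| <= L * `|x - y|) /\ forall x, Omega x -> f x = u x.
Proof.
move=> [L0 uL0].
have [-> |/set0P[y0 Oy0]] := eqVneq Omega set0.
  by exists 0, (fun=> 0); split => // x y; rewrite subrr normr0 mul0r.
pose L := `|L0| * n%:R.
have LL : 0 <= L by rewrite mulr_ge0.
have uL x y : Omega x -> Omega y -> `|u x - u y| <= L * `|x - y|.
  move=> Ox Oy; rewrite (le_trans (uL0 _ _ Ox Oy))//.
  rewrite (le_trans (ler_wpM2r _ (ler_norm _)))// ?sqrtr_ge0// -mulrA.
  by rewrite ler_wpM2l// enorm_le_norm.
pose E x : set R := [set u y + L * `|x - y| | y in Omega].
have Elb x : lbound (E x) (u y0 - L * `|x - y0|).
  move=> _ [y Oy <-]; rewrite lerBlDr.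
  have := uL _ _ Oy0 Oy; rewrite ler_norml => /andP[_ h].
  have : L * `|y0 - y| <= L * (`|x - y| + `|x - y0|).
    rewrite ler_wpM2l// (le_trans _ (ler_normB _ _))// (_ : x - y - (x - y0) = y0 - y)//.
    by rewrite opprB addrC addrA subrK.
  by move=> h'; lra.
have hE x : has_inf (E x).
  by split; [exists (u y0 + L * `|x - y0|); exists y0|exists (u y0 - L * `|x - y0|)].
pose f x := inf (E x).
have fle x y : Omega y -> f x <= u y + L * `|x - y|.
  by move=> Oy; apply: ge_inf; [case: (hE x)|exists y].
have flip x x' : f x <= f x' + L * `|x - x'|.
  rewrite -lerBlDr; apply: lb_le_inf; first by case: (hE x').
  move=> _ [y Oy <-]; rewrite lerBlDr (le_trans (fle x y Oy))// -addrA lerD2l -mulrDr.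
  by rewrite ler_wpM2l// [leRHS]addrC ler_distD.
exists L, f; split => [x y|x Ox].
  have := flip x y; have := flip y x; rewrite (distrC y) ler_norml => h1 h2.
  by apply/andP; split; lra.
apply/eqP; rewrite eq_le; apply/andP; split.
  by have := fle x x Ox; rewrite subrr normr0 mulr0 addr0.
apply: lb_le_inf; first by case: (hE x).
move=> _ [y Oy <-]; have := uL _ _ Ox Oy; rewrite ler_norml => /andP[_].
by rewrite lerBlDl.
Qed.

Lemma lipschitz_in_ae_differentiable Omega u : open Omega -> lipschitz_in Omega u ->
  {ae lebN (n:=n), forall x, Omega x -> differentiable u x}.
Proof.
move=> oO /mcshane_extension[L [f [fL fu]]].
have := rademacher fL; apply: filterS => x df Ox.
have xO : nbhs x Omega by exact: open_nbhs_nbhs.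
have fu' : \forall y \near x, f y = u y by apply: filterS xO => y /fu.
exact: (gradient_near fu' df).1.
Qed.

End mcshane.

(** * Norms and their duals *)

Section norm_duality.
Variables (R : realType) (n : nat).
Implicit Types (x y v w p q : 'rV[R]_n) (f : 'rV[R]_n -> R).

Record norm_between f (c C : R) : Prop := NormBetween {
  norm_between_gt0 : 0 < c;
  norm_betweenD : forall v w, f (v + w) <= f v + f w;
  norm_betweenZ : forall l v, f (l *: v) = `|l| * f v;
  norm_between_ge : forall v, c * `|v| <= f v;
  norm_between_le : forall v, f v <= C * `|v| }.

Definition polar f w := forall q, `|dot w q| <= f q.

Section duality.
Variables (f : 'rV[R]_n -> R) (c C : R).
Hypothesis fN : norm_between f c C.

Lemma norm_between0 : f 0 = 0.
Proof. by rewrite -(scale0r 0) (norm_betweenZ fN) normr0 mul0r. Qed.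

Lemma norm_betweenN v : f (- v) = f v.
Proof. by rewrite -scaleN1r (norm_betweenZ fN) normrN1 mul1r. Qed.

Lemma norm_between_dist v w : `|f v - f w| <= C * `|v - w|.
Proof.
rewrite (le_trans _ (norm_between_le fN _))// ler_norml.
have := norm_betweenD fN (v - w) w; have := norm_betweenD fN (w - v) v.
rewrite !subrK -(norm_betweenN (w - v)) opprB => h1 h2.
by apply/andP; split; lra.
Qed.

Lemma norm_between_upper_gt0 v : v != 0 -> 0 < C.
Proof.
move=> v0; have v1 : 0 < `|v| by rewrite normr_gt0.
rewrite -(pmulr_lgt0 _ v1) (lt_le_trans _ (le_trans (norm_between_ge fN v) (norm_between_le fN v)))//.
by rewrite mulr_gt0// (norm_between_gt0 fN).
Qed.

Lemma exists_rational_near w (e : R) : 0 < e ->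
  exists r : 'rV[rat]_n, `|w - map_mx ratr r| < e.
Proof.
move=> e0.
have /choice[r rP] : forall i, exists s : rat, `|w ord0 i - ratr s| < e.
  move=> i; have [|s] := @rat_in_itvoo R (w ord0 i - e) (w ord0 i + e).
    by rewrite ltrD2l gtrN.
  by rewrite in_itv/= -ltr_distl distrC => h; exists s.
exists (\row_i r i); apply: rV_norm_lt => // i.
by rewrite !mxE.
Qed.

(** Separation of p from the convex body K = {f <= k}: the vector w pointing
    from the nearest point of K to p, suitably scaled, is the functional
    sought. The symmetry of K gives the bound on the absolute value. *)
Lemma norm_separation p (k : R) : 0 < k -> k < f p ->
  exists2 w, polar f w & k < dot w p.
Proof.
move=> k0 kp; pose K := [set q | f q <= k].
have cf : continuous f by apply: (@lipschitz_continuous _ _ C); exact: norm_between_dist.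
have K0 : K 0 by rewrite /K/= norm_between0 ltW.
have cK : compact K.
  apply: bounded_closed_compact; last first.
    rewrite (_ : K = f @^-1` [set r | r <= k])//.
    by apply: closed_comp; [move=> x _; exact: cf|exact: closed_le].
  exists (k / c); split; first exact: num_real.
  move=> M kM q Kq; rewrite /= (le_trans _ (ltW kM))// ler_pdivlMr ?(norm_between_gt0 fN)//.
  by rewrite mulrC (le_trans (norm_between_ge fN _)).
pose D q := dot (p - q) (p - q).
have cD : {within K, continuous D}.
  have hadd : continuous (fun z : R * R => z.1 + z.2) by move=> z; apply: cvgD; [exact: cvg_fst|exact: cvg_snd].
  apply: continuous_subspaceT; apply: (continuous_big hadd) => i _ q.
  have ci : continuous (fun q : 'rV[R]_n => (p - q) ord0 i).
    apply: (@lipschitz_continuous _ _ 1) => s t; rewrite mul1r distrC.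
    have := ler_rV_coord (s - t) i.
    by rewrite !mxE (_ : _ - _ = p ord0 i - t ord0 i - (p ord0 i - s ord0 i)); last by ring.
  exact: cvgM (ci q) (ci q).
have [q0 Kq0 q0min] : exists2 q0, q0 \in K & forall q, q \in K -> D q0 <= D q.
  by apply: EVT_min_rV => //; exists 0.
rewrite inE in Kq0.
pose w := p - q0.
have var q : K q -> dot w q <= dot w q0.
  move=> Kq; rewrite leNgt; apply/negP => wq.
  pose d := q - q0; have wd : 0 < dot w d by rewrite dotBr subr_gt0.
  pose s := Num.min 1 (dot w d / (1 + dot d d)).
  have dd : 0 <= dot d d by apply: sumr_ge0 => i _; rewrite -expr2 sqr_ge0.
  have dd1 : 0 < 1 + dot d d by rewrite ltr_pwDl.
  have s0 : 0 < s by rewrite lt_min ltr01 divr_gt0.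
  have s1 : s <= 1 by rewrite ge_min lexx.
  have sd : s * (1 + dot d d) <= dot w d by rewrite -ler_pdivlMr// ge_min lexx orbT.
  have Ks : K (q0 + s *: d).
    rewrite /K/= (_ : q0 + s *: d = (1 - s) *: q0 + s *: q); last first.
      by apply/rowP => i; rewrite !mxE; ring.
    rewrite (le_trans (norm_betweenD fN _ _))// !(norm_betweenZ fN) !ger0_norm ?subr_ge0 ?(ltW s0)//.
    rewrite /K/= in Kq Kq0.
    rewrite (le_trans (lerD (ler_wpM2l _ Kq0) (ler_wpM2l _ Kq))) ?subr_ge0 ?(ltW s0)//.
    by rewrite -mulrDl subrK mul1r.
  (* moving from q0 towards q by a small s would decrease the distance to p *)
  have := q0min (q0 + s *: d); rewrite inE => /(_ Ks).
  have Dexp a b r : dot (a - r *: b) (a - r *: b) =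
      dot a a - 2 * r * dot a b + r * (r * dot b b) :> R.
    by rewrite dotBr !dotBl !dotZr !dotZl (dotC b a); ring.
  rewrite /D opprD addrA -/w Dexp => H.
  have sdd : s * dot d d < dot w d by lra.
  have := ltr_pM2l s0 (s * dot d d) (dot w d); rewrite sdd => ssdd.
  have swd : 0 < s * dot w d by rewrite mulr_gt0.
  clearbody s w d; lra.
have ww : 0 < dot w w.
  have w0 : w != 0 by rewrite subr_eq0; apply: contraTneq kp => ->; rewrite -leNgt.
  rewrite lt_neqAle; apply/andP; split; last first.
    by apply: sumr_ge0 => i _; rewrite -expr2 sqr_ge0.
  apply: contra w0 => /eqP/esym w0; apply/eqP/rowP => i; rewrite [RHS]mxE.
  have sq0 j : true -> 0 <= w ord0 j * w ord0 j by rewrite -expr2 sqr_ge0.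
  have wi0 : w ord0 i * w ord0 i = 0 by apply: (psumr_eq0P sq0 w0).
  by move/eqP: wi0; rewrite -expr2 sqrf_eq0 => /eqP.
have w0 : w != 0 by apply: contraTneq ww => ->; rewrite dot0l ltxx.
pose m := dot w q0.
have fw0 : 0 < f w.
  by rewrite (lt_le_trans _ (norm_between_ge fN w))// mulr_gt0 ?normr_gt0// (norm_between_gt0 fN).
have m0 : 0 < m.
  have kfw : 0 < k / f w by rewrite divr_gt0.
  have := var ((k / f w) *: w); rewrite /K/= (norm_betweenZ fN) (gtr0_norm kfw).
  rewrite divfK ?gt_eqF// lexx => /(_ isT); apply: lt_le_trans.
  by rewrite dotZr mulr_gt0// divr_gt0.
exists ((k / m) *: w); last first.
  have -> : p = q0 + w by rewrite addrC subrK.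
  rewrite dotZl dotDr -/m mulrDr divfK ?gt_eqF// ltrDl mulr_gt0// divr_gt0//.
move=> q; have [->|q_neq0] := eqVneq q 0; first by rewrite dot0r normr0 norm_between0.
have fq0 : 0 < f q.
  by rewrite (lt_le_trans _ (norm_between_ge fN q))// mulr_gt0 ?normr_gt0// (norm_between_gt0 fN).
have bnd s : `|s| = 1 -> dot w (s *: q) <= m / k * f q.
  have kfq : 0 < k / f q by rewrite divr_gt0.
  move=> s1; have := var ((k / f q) *: (s *: q)).
  rewrite /K/= !(norm_betweenZ fN) s1 mul1r (gtr0_norm kfq).
  rewrite divfK ?gt_eqF// lexx => /(_ isT).
  rewrite dotZr -ler_pdivlMl// invf_div.
  by rewrite (_ : f q / k * m = m / k * f q); last by ring.
rewrite dotZl normrM gtr0_norm ?divr_gt0// mulrC -ler_pdivlMr ?divr_gt0// invf_div.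
rewrite mulrC ler_norml lerNl; apply/andP; split.
  by rewrite -dotNr -scaleN1r bnd// normrN1.
by rewrite -{1}(scale1r q) bnd// normr1.
Qed.

(** The inequality k < <w, p> is strict, so there is room to shrink w by a
    factor t < 1, which makes the polarity strict as well, and then to round it
    to a rational vector. Rational directions are what makes the exceptional
    sets countable in number. *)
Lemma norm_separation_rat p (k : R) : 0 <= k -> k < f p ->
  exists2 w : 'rV[rat]_n, polar f (map_mx ratr w) & k < dot (map_mx ratr w) p.
Proof.
move=> k0 kp; pose k' := (k + f p) / 2.
have kk' : k < k' by rewrite /k'; lra.
have k'p : k' < f p by rewrite /k'; lra.
have k'0 : 0 < k' by exact: le_lt_trans kk'.
have [w wf wp] := norm_separation k'0 k'p.
have p0 : p != 0 by apply: contraTneq k'p => ->; rewrite norm_between0 -leNgt ltW.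
pose s := k / k'.
have s0 : 0 <= s by rewrite divr_ge0// ltW.
have s1 : s < 1 by rewrite ltr_pdivrMr// mul1r.
have swp : k < s * dot w p \/ k = 0.
  have [->|kn] := eqVneq k 0; [by right|left].
  have kp0 : 0 < k by rewrite lt_neqAle eq_sym kn.
  rewrite -[ltLHS](divfK (lt0r_neq0 k'0)) ltr_pM2l// divr_gt0//.
pose t := (1 + s) / 2.
have t1 : t < 1 by rewrite /t; lra.
have st : s < t by rewrite /t; lra.
have t0 : 0 < t by rewrite /t; lra.
have twp : k < t * dot w p.
  have wp0 : 0 < dot w p by exact: lt_trans wp.
  by case: swp => [h|->]; [rewrite (lt_trans h)// ltr_pM2r|rewrite mulr_gt0].
pose e := Num.min (c * (1 - t) / (n%:R + 1)) ((t * dot w p - k) / (n%:R * `|p| + 1)).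
have n1 : 0 < n%:R + 1 :> R by rewrite ltr_wpDl.
have np1 : 0 < n%:R * `|p| + 1 by rewrite ltr_wpDl// mulr_ge0.
have c1t : 0 < c * (1 - t) by rewrite mulr_gt0 ?(norm_between_gt0 fN)// subr_gt0.
have e0 : 0 < e.
  rewrite lt_min; apply/andP; split; apply: divr_gt0 => //.
  by rewrite subr_gt0.
have [r rw] := exists_rational_near (t *: w) e0.
have e1 : e * (n%:R + 1) <= c * (1 - t) by rewrite -ler_pdivlMr// ge_min lexx.
have e2 : e * (n%:R * `|p| + 1) <= t * dot w p - k by rewrite -ler_pdivlMr// ge_min lexx orbT.
set w' := map_mx ratr r in rw *.
exists r; rewrite -/w'.
  move=> q; have -> : w' = t *: w - (t *: w - w') by rewrite opprB addrC subrK.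
  rewrite dotBl (le_trans (ler_normB _ _))// dotZl normrM gtr0_norm//.
  rewrite (le_trans (lerD (ler_wpM2l (ltW t0) (wf q)) (dot_le _ _)))//.
  have h : n%:R * `|t *: w - w'| <= c * (1 - t).
    rewrite (le_trans _ e1)// mulrC (ler_pM _ _ (ltW rw))// lerDl//.
  have := ler_wpM2r (normr_ge0 q) h; have := norm_between_ge fN q => h1 h2.
  have t1' : 0 <= 1 - t by rewrite subr_ge0 ltW.
  have := ler_wpM2l t1' h1; move=> h3; lra.
have -> : w' = t *: w - (t *: w - w') by rewrite opprB addrC subrK.
rewrite dotBl dotZl.
have := dot_le (t *: w - w') p; rewrite ler_norml => /andP[_ h].
have h' : `|t *: w - w'| * (n%:R * `|p|) < e * (n%:R * `|p| + 1).
  rewrite mulrDr mulr1 (@le_lt_trans _ _ (e * (n%:R * `|p|)))//; last by rewrite ltrDl.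
  by rewrite ler_wpM2r ?mulr_ge0// ltW.
lra.
Qed.

End duality.
End norm_duality.

Section dual_norm.
Variables (R : realType) (n : nat).
Implicit Types (x y v w p q h : 'rV[R]_n) (f : 'rV[R]_n -> R).

Definition dual_norm f w : R := sup [set dot v w | v in [set v | f v <= 1]].

Variables (f : 'rV[R]_n -> R) (c C : R).
Hypothesis fN : norm_between f c C.

Let c0 : 0 < c := norm_between_gt0 fN.

Lemma unit_ball_bounded v : f v <= 1 -> `|v| <= c^-1.
Proof.
by move=> v1; rewrite -[leRHS]mul1r ler_pdivlMr// mulrC (le_trans (norm_between_ge fN v)).
Qed.

Lemma dot_unit_ball v w : f v <= 1 -> dot v w <= n%:R * c^-1 * `|w|.
Proof.
move=> v1; rewrite (le_trans (ler_norm _))// (le_trans (dot_le _ _))//.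
by rewrite ler_wpM2r// ler_wpM2l// unit_ball_bounded.
Qed.

Let unit0 : f 0 <= 1. Proof. by rewrite (norm_between0 fN). Qed.

Lemma dual_has_sup w : has_sup [set dot v w | v in [set v | f v <= 1]].
Proof.
split; first by exists (dot 0 w), 0.
by exists (n%:R * c^-1 * `|w|) => _ [v v1 <-]; exact: dot_unit_ball.
Qed.

Lemma dual_norm_ub v w : f v <= 1 -> dot v w <= dual_norm f w.
Proof. by move=> v1; apply: ub_le_sup; [case: (dual_has_sup w)|exists v]. Qed.

Lemma dual_norm_le w (b : R) :
  (forall v, f v <= 1 -> dot v w <= b) -> dual_norm f w <= b.
Proof.
move=> vb; apply: ge_sup; first by case: (dual_has_sup w).
by move=> _ [v v1 <-]; exact: vb.
Qed.

Lemma dual_norm_ge0 w : 0 <= dual_norm f w.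
Proof. by rewrite (le_trans _ (dual_norm_ub w unit0))// dot0l. Qed.

Lemma dot_le_dual v w : dot v w <= f v * dual_norm f w.
Proof.
have [->|v0] := eqVneq v 0; first by rewrite dot0l (norm_between0 fN) mul0r.
have fv : 0 < f v.
  by rewrite (lt_le_trans _ (norm_between_ge fN v))// mulr_gt0// normr_gt0.
rewrite mulrC -ler_pdivrMr// mulrC -dotZl; apply: dual_norm_ub.
by rewrite (norm_betweenZ fN) gtr0_norm ?invr_gt0// mulVf// gt_eqF.
Qed.

Lemma dual_norm_polar w : polar f w -> dual_norm f w <= 1.
Proof.
move=> wf; apply: dual_norm_le => v v1.
by rewrite dotC (le_trans (ler_norm _))// (le_trans (wf v)).
Qed.

Lemma dual_normD v w : dual_norm f (v + w) <= dual_norm f v + dual_norm f w.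
Proof.
by apply: dual_norm_le => u u1; rewrite dotDr lerD// dual_norm_ub.
Qed.

Lemma dual_normN w : dual_norm f (- w) = dual_norm f w.
Proof.
have H u : dual_norm f (- u) <= dual_norm f u.
  apply: dual_norm_le => v v1; rewrite dotNr -dotNl; apply: dual_norm_ub.
  by rewrite (norm_betweenN fN).
by apply/eqP; rewrite eq_le H -{1}(opprK w) H.
Qed.

Lemma dual_normZ_le (t : R) w : 0 < t -> dual_norm f (t *: w) <= t * dual_norm f w.
Proof.
move=> t0; apply: dual_norm_le => v v1.
by rewrite dotZr ler_pM2l// dual_norm_ub.
Qed.

Lemma dual_norm_upper w : dual_norm f w <= n%:R * c^-1 * `|w|.
Proof. by apply: dual_norm_le => v; exact: dot_unit_ball. Qed.

Lemma dual_norm_lower w : `|w| <= C * dual_norm f w.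
Proof.
have [->|w0] := eqVneq w 0.
  rewrite normr0.
  have -> : dual_norm f 0 = 0; last by rewrite mulr0.
  apply/eqP; rewrite eq_le dual_norm_ge0 andbT.
  by apply: dual_norm_le => v _; rewrite dot0r.
have C0 := norm_between_upper_gt0 fN w0.
apply: rV_norm_le; first by rewrite mulr_ge0 ?dual_norm_ge0// ltW.
move=> i.
have H s : `|s| = 1 -> s * w ord0 i <= C * dual_norm f w.
  move=> s1; rewrite -ler_pdivrMl//.
  have -> : C^-1 * (s * w ord0 i) = dot ((s / C) *: delta_mx ord0 i) w.
    by rewrite dotZl dotC dot_delta; ring.
  apply: dual_norm_ub; rewrite (norm_betweenZ fN) normrM s1 mul1r gtr0_norm ?invr_gt0//.
  rewrite -ler_pdivlMl ?invr_gt0// invrK (le_trans (norm_between_le fN _))//.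
  by rewrite -{1}(scale1r (delta_mx _ _)) normr_scale_delta normr1.
rewrite ler_norml lerNl; apply/andP; split.
  by rewrite -mulN1r H// normrN1.
by rewrite -(mul1r (w _ _)) H// normr1.
Qed.

(** The unit ball of the bidual norm lies in that of f: a functional that
    separates q from the latter would contradict the hypothesis. *)
Lemma dual_norm_bidual q : (forall h, dot q h <= dual_norm f h) -> f q <= 1.
Proof.
move=> qf; rewrite leNgt; apply/negP => q1.
have [w wf w1] := norm_separation fN ltr01 q1.
by have := le_lt_trans (le_trans (qf w) (dual_norm_polar wf)) (_ : 1 < dot q w);
  rewrite ltxx dotC => /(_ w1).
Qed.

Lemma dual_norm_dist v w : dual_norm f v - dual_norm f w <= dual_norm f (v - w).
Proof. by rewrite lerBlDr -{1}(subrK w v) dual_normD. Qed.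

End dual_norm.

Section finsler_norms.
Variables (R : realType) (n : nat).
Implicit Types (x y v w p q h : 'rV[R]_n) (Omega : set 'rV[R]_n) (F : 'rV[R]_n -> 'rV[R]_n -> R).

(** Convexity at the midpoint, together with homogeneity, is the triangle
    inequality. *)
Lemma convex_homogeneous_subadditive f v w : convex_function setT (f : 'rV[R]_n -> R) ->
  (forall (l : R) v, f (l *: v) = `|l| * f v) -> f (v + w) <= f v + f w.
Proof.
move=> cf hf.
have h2 : 0 <= (2^-1 : R) <= 1 by rewrite invr_ge0 ler0n/= invf_le1// ler1n.
have H : f (2^-1 *: v + (1 - 2^-1) *: w) <= 2^-1 * f v + (1 - 2^-1) * f w.
  by have := cf (Itv01 (andP h2).1 (andP h2).2) v w; rewrite !inE => /(_ I I).
have E := hf 2^-1 (v + w); rewrite gtr0_norm ?invr_gt0// in E.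
have h : (1 - 2^-1 : R) = 2^-1 by rewrite {1}(splitr 1) mul1r addrK.
by move: H; rewrite h -scalerDr E => H; lra.
Qed.

Lemma admissible_norm_between Omega F : admissible Omega F ->
  exists lambda : 'rV[R]_n -> R, [/\ {within Omega, continuous lambda},
    forall x, Omega x -> 1 <= lambda x
    & {ae lebN (n:=n), forall x, Omega x ->
       norm_between (F x) (lambda x)^-1 (lambda x * n%:R)}].
Proof.
move=> aF; have [lambda [cl l1 bl]] := admissible_bounds aF.
exists lambda; split=> //.
move: (admissible_convex aF) (finsler_homogeneous aF) bl; rewrite /ae_in.
apply: filterS3 => x cx hx bx Ox.
have l0 : 0 < lambda x by rewrite (lt_le_trans ltr01)// l1.
split; first by rewrite invr_gt0.
- by move=> v w; apply: convex_homogeneous_subadditive; [exact: cx|exact: hx].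
- exact: hx.
- move=> v; have /andP[h _] := bx Ox v; apply: le_trans h.
  by rewrite ler_wpM2l ?invr_ge0 ?(ltW l0)// enorm_ge_norm.
- move=> v; have /andP[_ h] := bx Ox v; apply: le_trans h _.
  by rewrite -mulrA ler_wpM2l ?(ltW l0)// enorm_le_norm.
Qed.

End finsler_norms.

(** * Test functions and the upper bound *)

Section test_functions.
Variables (R : realType) (n : nat).
Implicit Types (x y z v w p q h : 'rV[R]_n) (Omega : set 'rV[R]_n) (F : 'rV[R]_n -> 'rV[R]_n -> R).
Implicit Types (u : 'rV[R]_n -> R).

(** The functions over which the intrinsic distance is a supremum, with the
    essential supremum unfolded; see intrinsic_distE. *)
Definition test_fun Omega F u := lipschitz_in Omega u /\
  {ae lebN (n:=n), forall z, Omega z -> F z (gradient u z) <= 1}.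

Lemma Linfty_norm_le1 Omega (g : 'rV[R]_n -> R) : (forall z, Omega z -> 0 <= g z) ->
  (Linfty_norm Omega g <= 1)%E <->
  {ae lebN (n:=n), forall z, Omega z -> g z <= 1}.
Proof.
move=> g0; rewrite /Linfty_norm unlock.
have E z : Omega z -> ((EFin \o g) \_ Omega) z = (g z)%:E by move=> Oz; rewrite patchE mem_set.
have E' z : ~ Omega z -> ((EFin \o g) \_ Omega) z = 0%E by move=> Oz; rewrite patchE memNset.
case: ifPn => [_|T0].
  split => [/ess_supP|H].
    apply: filterS => z + Oz; rewrite /= E// gee0_abs ?lee_fin ?g0//.
  apply/ess_supP; move: H; apply: filterS => z H /=.
  have [Oz|nOz] := pselect (Omega z); last by rewrite E'// abse0.
  by rewrite E// gee0_abs ?lee_fin ?g0//; exact: H.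
split => // _; exists setT; split => //.
by apply/eqP; rewrite eq_le measure_ge0 andbT leNgt.
Qed.

Lemma intrinsic_distE Omega F x y : (forall z v, Omega z -> 0 <= F z v) ->
  intrinsic_dist Omega F x y =
  ereal_sup [set (u x - u y)%:E | u in test_fun Omega F].
Proof.
move=> F0; rewrite /intrinsic_dist; congr ereal_sup.
have HF u := @Linfty_norm_le1 Omega (fun z => F z (gradient u z)) (fun z Oz => F0 z _ Oz).
by apply/seteqP; split => _ [u [lu Hu] <-]; exists u => //; split => //; apply/HF.
Qed.

Lemma usc_at_le Omega (w : 'rV[R]_n -> R) x (e : R) : usc_at Omega w x -> 0 < e ->
  \forall y \near x, Omega y -> w y <= w x + e.
Proof.
rewrite /usc_at /limf_esup => wx e0.
have : (ereal_inf [set ereal_sup ((EFin \o w) @` V) | V in within Omega x^'] < (w x + e)%:E)%E.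
  by rewrite (le_lt_trans wx)// lte_fin ltrDl.
move=> /ereal_inf_lt[_ [V VF <-] Vlt].
have VF' : nbhs x [set y | y != x -> Omega y -> V y] by exact: VF.
apply: filterS VF' => y Vy Oy.
have [->|yx] := eqVneq y x; first by rewrite lerDl ltW.
rewrite -lee_fin (le_trans _ (ltW Vlt))//; apply: ereal_sup_ubound.
by exists y => //; exact: Vy.
Qed.

Lemma within_continuous_bounded Omega (lambda : 'rV[R]_n -> R) x :
  open Omega -> Omega x -> {within Omega, continuous lambda} ->
  \forall y \near x, Omega y -> lambda y <= lambda x + 1.
Proof.
move=> oO Ox cl.
rewrite continuous_open_subspace// in cl.
have /cvgrPdist_le/(_ 1 ltr01) := cl x (mem_set Ox).
by apply: filterS => y; rewrite ler_distlC => /andP[].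
Qed.

End test_functions.

Section upper_bound.
Variables (R : realType) (n : nat).
Implicit Types (x y z v w p q h : 'rV[R]_n) (Omega : set 'rV[R]_n) (F : 'rV[R]_n -> 'rV[R]_n -> R).
Implicit Types (u : 'rV[R]_n -> R).

(** Indexed by a finite type, so that conditions on neighbourhoods which hold
    at each grid point hold at all of them simultaneously. *)
Definition grid_point (N : nat) (k : {ffun 'I_n -> 'I_(2 * N.+1).+1}) : 'rV[rat]_n :=
  \row_i (((k i)%:R - N.+1%:R) / N.+1%:R).

Lemma grid_point_near (N : nat) v : `|v| <= 1 ->
  exists k, `|v - map_mx ratr (@grid_point N k)| <= N.+1%:R^-1.
Proof.
move=> v1.
have N0 : 0 < N.+1%:R :> R by [].
have vi i : -1 <= v ord0 i <= 1.
  by rewrite -ler_norml (le_trans (ler_rV_coord v i)).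
have ki i : (Num.truncn ((v ord0 i + 1) * N.+1%:R) < (2 * N.+1).+1)%N.
  have /andP[h1 h2] := vi i.
  rewrite ltnS -(ler_nat R); have := truncn_itv (_ : 0 <= (v ord0 i + 1) * N.+1%:R).
  rewrite mulr_ge0//; last by lra.
  move=> /(_ isT)/andP[h _]; rewrite (le_trans h)// natrM ler_pM2r//; lra.
exists [ffun i => Ordinal (ki i)]; apply: rV_norm_le; first by rewrite invr_ge0 ltW.
move=> i; rewrite !mxE ffunE/=.
have /andP[h1 h2] := vi i.
have := truncn_itv (_ : 0 <= (v ord0 i + 1) * N.+1%:R).
rewrite mulr_ge0//; last by lra.
set m := Num.truncn _ => /(_ isT)/andP[h3 h4].
rewrite fmorph_div/= rmorphB/= !ratr_nat.
have -> : v ord0 i - (m%:R - N.+1%:R) / N.+1%:R = ((v ord0 i + 1) * N.+1%:R - m%:R) / N.+1%:R.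
  have Na : N.+1%:R != 0 :> R by rewrite pnatr_eq0.
  by move: (N.+1%:R) Na => a a0; field.
rewrite normrM (gtr0_norm (_ : 0 < N.+1%:R^-1)) ?invr_gt0// ler_piMl ?invr_ge0//.
by rewrite ger0_norm ?subr_ge0// lerBlDl natr1 ltW.
Qed.

(** Semicontinuity in x for each fixed v becomes uniform in v: the norms F z,
    for z close to x, share a Lipschitz constant, so finitely many grid points
    v control the whole unit ball, and homogeneity does the rest. *)
Lemma usc_uniform Omega F x (lambda : 'rV[R]_n -> R) (La c C : R) :
  norm_between (F x) c C -> 0 <= La -> 0 <= C ->
  (forall v : 'rV[rat]_n, usc_at Omega (F ^~ (map_mx ratr v)) x) ->
  (\forall y \near x, Omega y -> lambda y <= La) ->
  forall e, 0 < e -> \forall z \near x, Omega z ->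
    norm_between (F z) (lambda z)^-1 (lambda z * n%:R) ->
    forall v, F z v <= F x v + e * `|v|.
Proof.
move=> Fx La0 C0 usc laLa e e0.
have e2 : 0 < e / 2 by rewrite divr_gt0.
have K0 : 0 < La * n%:R + C + 1 by rewrite ltr_wpDl// addr_ge0// mulr_ge0.
have [N _ /(_ _ (leqnn _)) HN] :
    \forall N \near \oo, N.+1%:R^-1 < e / 2 / (La * n%:R + C + 1) :> R.
  have ee : 0 < e / 2 / (La * n%:R + C + 1) by rewrite divr_gt0.
  exact: near_infty_natSinv_lt (PosNum ee).
have grid : \forall z \near x, forall k : {ffun 'I_n -> 'I_(2 * N.+1).+1},
    Omega z -> F z (map_mx ratr (grid_point k)) <= F x (map_mx ratr (grid_point k)) + e / 2.
  have gk (k : {ffun 'I_n -> 'I_(2 * N.+1).+1}) : \forall z \near nbhs x,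
      Omega z -> F z (map_mx ratr (grid_point k)) <= F x (map_mx ratr (grid_point k)) + e / 2.
    exact: (usc_at_le (usc (grid_point k)) e2).
  exact: (@filter_forall _ _ _ (nbhs x) _ gk).
move: grid laLa; apply: filterS2 => z gz lz Oz Fz.
have key v : `|v| <= 1 -> F z v <= F x v + e.
  move=> v1; have [k vk] := grid_point_near N v1.
  have := gz k Oz; set vk' := map_mx _ _ in vk * => g.
  have := norm_between_dist Fz v vk'; rewrite ler_norml => /andP[_ h1].
  have := norm_between_dist Fx v vk'; rewrite ler_norml => /andP[h2 _].
  have h3 : lambda z * n%:R * `|v - vk'| <= La * n%:R * N.+1%:R^-1.
    apply: (@le_trans _ _ (La * n%:R * `|v - vk'|)).
      by rewrite ler_wpM2r// ler_wpM2r// lz.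
    by rewrite ler_wpM2l// mulr_ge0.
  have h4 : C * `|v - vk'| <= C * N.+1%:R^-1 by rewrite ler_wpM2l.
  have h5 : N.+1%:R^-1 * (La * n%:R + C + 1) <= e / 2.
    by rewrite -ler_pdivlMr// ltW.
  have N0 : 0 <= N.+1%:R^-1 :> R by rewrite invr_ge0.
  set i := N.+1%:R^-1 in h3 h4 h5 N0.
  clearbody i; lra.
move=> v; have [->|v0] := eqVneq v 0.
  by rewrite (norm_between0 Fz) (norm_between0 Fx) normr0 mulr0 addr0.
have nv : 0 < `|v| by rewrite normr_gt0.
have -> : v = `|v| *: (`|v|^-1 *: v) by rewrite scalerA mulfV ?scale1r// gt_eqF.
set v' := `|v|^-1 *: v.
have v'1 : `|v'| = 1 by rewrite normrZ gtr0_norm ?invr_gt0// mulVf// gt_eqF.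
rewrite (norm_betweenZ Fz) (norm_betweenZ Fx) normrZ v'1 mulr1 !normr_id.
rewrite [e * _]mulrC -mulrDr ler_pM2l//.
by apply: key; rewrite v'1.
Qed.

Lemma gradient_dot_le (g N : 'rV[R]_n -> R) z :
  differentiable g z ->
  (forall h (t : R), 0 < t -> g (z + t *: h) - g z <= t * N h) ->
  forall h, dot (gradient g z) h <= N h.
Proof.
move=> dg gN h; apply/ler_addgt0Pr => e e0.
have [->|h0] := eqVneq h 0.
  rewrite dot0r; have := gN 0 1 ltr01; rewrite scaler0 addr0 subrr mul1r => H.
  by rewrite addr_ge0// ltW.
have nh : 0 < `|h| by rewrite normr_gt0.
have [d d0 H] := differentiable_first_order dg (divr_gt0 e0 nh).
pose t := d / (2 * `|h|).
have t0 : 0 < t by rewrite divr_gt0// mulr_gt0.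
have th : `|t *: h| = d / 2.
  by rewrite normrZ gtr0_norm// /t invfM mulrA divfK// gt_eqF.
have := H (t *: h); rewrite th ltr_pdivrMr// ltr_pMr// ltr1n => /(_ isT).
rewrite dotZr ler_norml => /andP[h1 _].
have := gN h t t0 => h2.
have e1 : e / `|h| * (d / 2) = t * e.
  by rewrite /t; field; rewrite gt_eqF.
rewrite e1 in h1.
by rewrite -(ler_pM2l t0); lra.
Qed.

Section at_point.
Variables (Omega : set 'rV[R]_n) (F : 'rV[R]_n -> 'rV[R]_n -> R).
Variables (lambda : 'rV[R]_n -> R) (x : 'rV[R]_n) (c C La : R).
Hypotheses (Ox : Omega x) (Fx : norm_between (F x) c C) (C0 : 0 < C).
Hypothesis Fnorm : {ae lebN (n:=n), forall z, Omega z ->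
  norm_between (F z) (lambda z)^-1 (lambda z * n%:R)}.
Hypothesis F_usc : forall v : 'rV[rat]_n, usc_at Omega (F ^~ (map_mx ratr v)) x.
Hypothesis lambda_le : \forall y \near x, Omega y -> lambda y <= La.
Hypothesis La0 : 0 <= La.

(** The cone z |-> D (z - x), with D the norm dual to F x, has gradients in
    the unit ball of F x, because D is 1-Lipschitz for itself and the bidual of
    F x is F x. Truncating it at a small height k makes it constant outside a
    small ball, and inside this ball F z is at most (1 + e) times F x by upper
    semicontinuity; so the truncated cone divided by 1 + e is a test
    function. The sign is the one for which u x - u y is an increment of the
    cone. *)
Lemma cone_test_fun (e : R) : 0 < e -> exists2 k, 0 < k &
  test_fun Omega F (fun z => - (Num.min (dual_norm (F x) (z - x)) k / (1 + e))).
Proof.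
move=> e0; have c0 := norm_between_gt0 Fx.
have := usc_uniform Fx La0 (ltW C0) F_usc lambda_le (mulr_gt0 e0 c0).
move=> /nbhs_ballP[r /= r0 Hr].
pose k := r / (2 * C); have k0 : 0 < k by rewrite divr_gt0// mulr_gt0.
exists k => //.
pose D := dual_norm (F x).
pose g z := - (Num.min (D (z - x)) k / (1 + e)).
have e1 : 0 < 1 + e by rewrite addr_gt0.
have gD z z' : g z - g z' <= D (z - z') / (1 + e).
  rewrite /g opprK addrC -mulrBl ler_pM2r ?invr_gt0//.
  have h1 : D (z' - x) - D (z - x) <= D (z - z').
    rewrite /D -(dual_normN Fx (z - z')) opprB.
    by rewrite (le_trans (dual_norm_dist Fx _ _))// opprB addrA subrK.
  have h2 := dual_norm_ge0 Fx (z - z').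
  have [h3|h3] := leP (D (z' - x)) k; have [h4|h4] := leP (D (z - x)) k; rewrite -?/D in h2 *; lra.
pose M := n%:R * c^-1 / (1 + e).
have gL z z' : `|g z - g z'| <= M * `|z - z'|.
  have H a b : g a - g b <= M * `|a - b|.
    rewrite (le_trans (gD _ _))// /M [leRHS]mulrAC ler_pM2r ?invr_gt0//.
    exact: (dual_norm_upper Fx).
  by rewrite ler_norml H andbT lerNl opprB distrC H.
split.
  exists M => z z' _ _; rewrite (le_trans (gL z z'))//.
  by rewrite ler_wpM2l ?enorm_ge_norm// divr_ge0 ?(ltW e1)// mulr_ge0// invr_ge0 ltW.
move: Fnorm (rademacher gL); apply: filterS2 => z Fz dg Oz.
have {}Fz := Fz Oz; rewrite -/g.
(* above the height k the function is locally constant *)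
have [Dk|Dk] := ltP k (D (z - x)).
  have near_k : \forall y \near z, g y = (fun=> - (k / (1 + e))) y.
    have cD : {for z, continuous (fun y => D (y - x))}.
      apply: (@lipschitz_continuous _ _ (n%:R * c^-1) (fun y => D (y - x))) => a b.
      have H a' b' : D (a' - x) - D (b' - x) <= n%:R * c^-1 * `|a' - b'|.
        rewrite (le_trans (dual_norm_dist Fx _ _))// opprB addrA subrK.
        exact: (dual_norm_upper Fx).
      by rewrite ler_norml H andbT lerNl opprB distrC H.
    have : \forall y \near z, k < D (y - x) by exact: cvgr_gt cD _ Dk.
    by apply: filterS => y ky; rewrite /g min_r// ltW.
  have -> : gradient g z = 0.
    have [_ <-] := gradient_near near_k dg.
    apply: (first_order_differentiable _).2 => d d0; exists 1 => // h _.
    by rewrite subrr dot0l subrr normr0 mulr_ge0// ltW.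
  by rewrite (norm_between0 Fz).
have zx : `|z - x| < r.
  rewrite (le_lt_trans (dual_norm_lower Fx (z - x)))// -/D.
  rewrite (@le_lt_trans _ _ (C * k))//; first by rewrite ler_pM2l.
  rewrite /k mulrCA (_ : C / (2 * C) = 2^-1) ?ltr_pdivrMr ?ltr_pMr ?ltr1n//.
  by field; rewrite gt_eqF.
have Fzle := Hr z; rewrite -ball_normE/= distrC in Fzle.
have {}Fzle := Fzle zx Oz Fz.
pose q := (1 + e) *: gradient g z.
have q1 : F x q <= 1.
  apply: (dual_norm_bidual Fx) => h.
  rewrite dotZl mulrC -ler_pdivlMr//.
  apply: (gradient_dot_le (N := fun h => D h / (1 + e)) dg) => h' t t0.
  rewrite (le_trans (gD _ _))// addrAC subrr add0r mulrA ler_pM2r ?invr_gt0//.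
  exact: (dual_normZ_le Fx).
have q2 : `|q| <= c^-1 by exact: (unit_ball_bounded Fx).
have : F z q <= 1 + e.
  rewrite (le_trans (Fzle q))// lerD// -mulrA -[leRHS]mulr1 ler_pM2l//.
  by rewrite -(mulfV (lt0r_neq0 c0)) ler_pM2l.
by rewrite (norm_betweenZ Fz) gtr0_norm// -ler_pdivlMl// mulVf// gt_eqF.
Qed.

Hypothesis F_ge0 : forall z v, Omega z -> 0 <= F z v.
Local Notation D := (dual_norm (F x)).
Local Notation delta := (intrinsic_dist Omega F).

Lemma dual_norm_le_intrinsic_dist (e : R) : 0 < e ->
  \forall y \near x, Omega y -> ((D (y - x) / (1 + e))%:E <= delta x y)%E.
Proof.
move=> e0; have [k k0 tk] := cone_test_fun e0.
have c0 := norm_between_gt0 Fx.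
have K0 : 0 < n%:R * c^-1 + 1 by rewrite ltr_wpDl// mulr_ge0// invr_ge0 ltW.
apply/nbhs_ballP; exists (k / (n%:R * c^-1 + 1)); first by rewrite /= divr_gt0.
move=> y; rewrite -ball_normE/= distrC ltr_pdivlMr// => yx Oy.
rewrite intrinsic_distE//; apply: ereal_sup_ubound.
exists (fun z => - (Num.min (D (z - x)) k / (1 + e))) => //; congr EFin.
have -> : D (x - x) = 0.
  apply/eqP; rewrite eq_le (dual_norm_ge0 Fx) andbT subrr.
  by rewrite (le_trans (dual_norm_upper Fx _))// normr0 mulr0.
rewrite (min_l (ltW k0)) mul0r oppr0 add0r opprK min_l//.
rewrite (le_trans (dual_norm_upper Fx _))// (le_trans _ (ltW yx))//.
by rewrite mulrC ler_wpM2l// lerDl.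
Qed.

Lemma ereal_div_le (a d b : R) (t : \bar R) : 0 <= a -> 0 < d -> (d%:E <= t)%E ->
  a <= b * d -> (a%:E / t <= b%:E)%E.
Proof.
move=> a0 d0 dt ab.
have b0 : 0 <= b by rewrite -(pmulr_lge0 _ d0) (le_trans a0).
case: t dt => [r| |]; last by [].
  rewrite lee_fin => dr; have r0 : 0 < r by exact: lt_le_trans dr.
  rewrite inver gt_eqF// -EFinM lee_fin ler_pdivrMr// (le_trans ab)//.
  by rewrite ler_wpM2l.
by move=> _; rewrite invey mule0 lee_fin.
Qed.

(** The quotient of |u y - u x| by the intrinsic distance is compared with
    that of |<p, h>| by D h, where h = y - x and p is the gradient; the latter
    quotient is at most F x p by the definition of the dual norm. *)
Lemma pointwise_lip_le u : differentiable u x ->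
  (pointwise_lip Omega delta u x <= (F x (gradient u x))%:E)%E.
Proof.
move=> du; set p := gradient u x; set f := F x p.
have f0 : 0 <= f by exact: F_ge0.
apply/lee_addgt0Pr => eta eta0.
pose e := Num.min 1 (eta / (f + 2)).
have f2 : 0 < f + 2 by rewrite ltr_wpDl.
have e0 : 0 < e by rewrite lt_min ltr01 divr_gt0.
have e1 : e <= 1 by rewrite ge_min lexx.
have ef : e * (f + 2) <= eta by rewrite -ler_pdivlMr// ge_min lexx orbT.
have efe : (f + e) * (1 + e) <= f + eta by nra.
have [d d0 Hu] := differentiable_first_order du (divr_gt0 e0 C0).
have nd := dual_norm_le_intrinsic_dist e0.
have nb : \forall y \near x, `|y - x| < d.
  by apply/nbhs_ballP; exists d => // y; rewrite -ball_normE/= distrC.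
rewrite /pointwise_lip /limf_esup; apply: ge_ereal_inf.
pose V := [set y | y != x /\ ((D (y - x) / (1 + e))%:E <= delta x y)%E /\ `|y - x| < d].
exists (ereal_sup ((fun y => `|u y - u x|%:E / delta x y)%E @` V)).
  exists V => //.
  have VE : nbhs x [set y | y != x -> Omega y -> V y].
    by move: nd nb; apply: filterS2 => y h1 h2 yx Oy; split => //; split => //; exact: h1.
  exact: VE.
apply: ge_ereal_sup => _ [y [yx [dy yd]] <-].
pose h := y - x.
have hy : y = x + h by rewrite /h addrC subrK.
have h0 : 0 < `|h| by rewrite normr_gt0 subr_eq0.
have Dh : 0 < D h.
  by rewrite -(pmulr_rgt0 _ C0) (lt_le_trans h0)// (dual_norm_lower Fx).
have e10 : 0 < 1 + e by rewrite addr_gt0.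
apply: (@ereal_div_le _ (D h / (1 + e))) => //; first exact: divr_gt0.
apply: (@le_trans _ _ ((f + e) * D h)).
  have := Hu h yd; rewrite -hy ler_norml => /andP[a1 a2].
  have a3 := dot_le_dual Fx p h; have := dot_le_dual Fx p (- h).
  rewrite dotNr (dual_normN Fx) -/f => a4.
  have a5 : e / C * `|h| <= e * D h.
    by rewrite -mulrA ler_pM2l// ler_pdivrMl// (dual_norm_lower Fx).
  rewrite -/f in a3; rewrite -/p in a1 a2.
  rewrite ler_norml mulrDl; apply/andP; split; lra.
by rewrite mulrA ler_pdivlMr// -mulrA (mulrC (D h)) mulrA ler_pM2r.
Unshelve. all: by end_near. Qed.

End at_point.
End upper_bound.

(** * The lower bound *)

Section increments.
Variables (R : realType) (n : nat).
Local Notation leb := (@lebesgue_measure R).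
Implicit Types (x y z v w p q h : 'rV[R]_n) (Omega : set 'rV[R]_n) (F : 'rV[R]_n -> 'rV[R]_n -> R).
Implicit Types (u : 'rV[R]_n -> R) (N : set (borel_rV R n)).

(** The mean value inequality on a segment. The Lipschitz function u need
    only be differentiable at almost every point of the segment, that is off a
    null set N whose trace on the line is null. *)
Lemma increment_le_along Omega u y v (t K M : R) (B : set R) N :
  open Omega -> lipschitz_in Omega u -> 0 < t ->
  (forall s, 0 <= s <= t -> Omega (y + s *: v)) ->
  measurable N -> leb (line_trace N v y) = 0%E -> measurable B ->
  0 <= K -> 0 <= M ->
  (forall s, 0 < s < t -> ~ N (y + s *: v) -> differentiable u (y + s *: v) /\
     dot (gradient u (y + s *: v)) v <= K + M * (s \notin B)%:R) ->
  ((u (y + t *: v) - u y)%:E <= (K * t)%:E + M%:E * leb (`]0%R, t] `\` B))%E.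
Proof.
move=> oO lu t0 seg mN N0 mB K0 M0 H.
have [L [f [fL fu]]] := mcshane_extension lu.
pose g s := f (y + s *: v).
have gL s s' : `|g s - g s'| <= (`|L| * `|v|) * `|s - s'|.
  rewrite (le_trans (fL _ _))// opprD addrACA subrr add0r -scalerBl normrZ.
  rewrite -mulrA (mulrC `|v|); apply: ler_wpM2r; first by rewrite mulr_ge0.
  exact: ler_norm.
have Oy : Omega y by have := seg 0; rewrite scale0r addr0 lexx ltW//; exact.
have Oyt : Omega (y + t *: v) by apply: seg; rewrite lexx ltW.
have := @lipschitz_increment_le R g _ 0 t K M B gL t0 K0 M0 mB.
rewrite /g scale0r addr0 !fu// subr0; apply.
exists (line_trace N v y); split => //; first exact: measurable_line_trace.
move=> s /= /not_implyP[]; rewrite in_itv/= => st; apply: contra_notP => nN d gd.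
have [du dle] := H s st nN; apply: le_trans dle.
have Os : Omega (y + s *: v).
  by apply: seg; case/andP: st => s0 st; rewrite !ltW.
have nuf : \forall z \near y + s *: v, u z = f z.
  have nO : nbhs (y + s *: v) Omega by exact: open_nbhs_nbhs.
  by apply: filterS nO => z /fu.
have [df <-] := gradient_near nuf du.
have [_ <-] := is_derive_line df.
by case: gd => _ <-.
Qed.

Lemma ball_segment x y v (r s : R) : ball x r y -> ball x r (y + v) -> 0 <= s <= 1 ->
  ball x r (y + s *: v).
Proof.
rewrite -!ball_normE/= => h1 h2 /andP[s0 s1].
have -> : x - (y + s *: v) = (1 - s) *: (x - y) + s *: (x - (y + v)).
  by apply/rowP => i; rewrite !mxE; ring.
rewrite (le_lt_trans (ler_normD _ _))// !normrZ (ger0_norm s0) ger0_norm ?subr_ge0//.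
have [->|sn0] := eqVneq s 0; first by rewrite subr0 mul1r mul0r addr0.
have sp : 0 < s by rewrite lt_neqAle eq_sym sn0.
have : s * `|x - (y + v)| < s * r by rewrite ltr_pM2l.
have : (1 - s) * `|x - y| <= (1 - s) * r by rewrite ler_wpM2l ?subr_ge0// ltW.
by move=> a b; lra.
Qed.

Section norms.
Variables (Omega : set 'rV[R]_n) (F : 'rV[R]_n -> 'rV[R]_n -> R) (lambda : 'rV[R]_n -> R).
Hypothesis oO : open Omega.
Hypothesis lambda1 : forall z, Omega z -> 1 <= lambda z.
Hypothesis Fnorm : {ae lebN (n:=n), forall z, Omega z ->
  norm_between (F z) (lambda z)^-1 (lambda z * n%:R)}.

Definition regular_pt u z := [/\ norm_between (F z) (lambda z)^-1 (lambda z * n%:R),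
  differentiable u z & F z (gradient u z) <= 1].

Lemma test_fun_regular u : test_fun Omega F u ->
  {ae lebN (n:=n), forall z, Omega z -> regular_pt u z}.
Proof.
move=> [lu Fu]; move: Fnorm Fu (lipschitz_in_ae_differentiable oO lu).
by apply: filterS3 => z h1 h2 h3 Oz; split; [exact: h1|exact: h3|exact: h2].
Qed.

Lemma regular_pt_gradient u z : Omega z -> regular_pt u z ->
  `|gradient u z| <= lambda z.
Proof.
move=> Oz [Fz _ F1]; have l0 : 0 < lambda z by rewrite (lt_le_trans ltr01)// lambda1.
by rewrite -[lambda z]invrK; exact: (unit_ball_bounded Fz F1).
Qed.

Lemma regular_pt_dot u z v (La : R) : Omega z -> lambda z <= La -> regular_pt u z ->
  dot (gradient u z) v <= n%:R * La * `|v|.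
Proof.
move=> Oz zL uz; rewrite (le_trans (ler_norm _))// (le_trans (dot_le _ _))//.
by rewrite ler_wpM2r// ler_wpM2l// (le_trans (regular_pt_gradient Oz uz)).
Qed.

(** Test functions are Lipschitz on small balls with one common constant. If
    the increment from y to y' were too large, it would still be so along a
    nearby parallel segment, and almost every parallel segment consists
    almost everywhere of regular points, where the gradient is bounded by La. *)
Lemma test_fun_lipschitz_on_ball u x (r La : R) y y' :
  ball x r `<=` Omega -> (forall z, ball x r z -> lambda z <= La) -> 0 <= La ->
  test_fun Omega F u -> ball x r y -> ball x r y' ->
  u y' - u y <= n%:R * La * `|y' - y|.
Proof.
move=> xrO xrL La0 tu xy xy'; rewrite leNgt; apply/negP => uK.
pose v := y' - y; set K := n%:R * La * `|y' - y| in uK.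
have K0 : 0 <= K by rewrite !mulr_ge0.
have [L [f [fL fu]]] := mcshane_extension tu.1.
have L1 : 0 < 2 * `|L| + 1 by rewrite ltr_wpDl// mulr_ge0.
have [N [mN N0 NP]] := test_fun_regular tu.
pose De := u y' - u y - K.
have De0 : 0 < De by rewrite subr_gt0.
pose rho := Num.min (De / (2 * `|L| + 1)) (Num.min (r - `|x - y|) (r - `|x - y'|)).
have rho0 : 0 < rho.
  by rewrite !lt_min divr_gt0//= !subr_gt0; move: xy xy'; rewrite -ball_normE/= => -> ->.
have [z [yz zN]] := ae_meets_open (null_ae_line v mN N0) (ball_open y rho) (ballxx y rho0).
move: yz; rewrite -ball_normE/= !lt_min => /and3P[yz1 yz2 yz3].
have xz : ball x r z.
  rewrite -ball_normE/= -(subrK y x) -addrA (le_lt_trans (ler_normD _ _))//.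
  by rewrite -ltrBrDl.
have xzv : ball x r (z + v).
  rewrite -ball_normE/= (_ : x - (z + v) = (x - y') + (y - z)); last first.
    by apply/rowP => i; rewrite !mxE; ring.
  by rewrite (le_lt_trans (ler_normD _ _))// -ltrBrDl.
have seg s : 0 <= s <= 1 -> ball x r (z + s *: v) by exact: ball_segment.
have := @increment_le_along Omega u z v 1 K 0 setT N oO tu.1 ltr01
  (fun s s01 => xrO _ (seg s s01)) mN zN measurableT K0 (lexx 0).
rewrite scale1r mul0e adde0 mulr1 lee_fin.
have [Oz Ozv] := (xrO _ xz, xrO _ xzv).
have -> : (u (z + v) - u z <= K) = false.
  apply/negbTE; rewrite -ltNge -!fu//.
  have := fL (z + v) y'; have := fL z y; rewrite !fu//; [|exact: xrO|exact: xrO].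
  rewrite (_ : z + v - y' = z - y); last by apply/rowP => i; rewrite !mxE; ring.
  rewrite !ler_norml => /andP[_ h1] /andP[h2 _].
  have h3 : L * `|z - y| <= `|L| * `|y - z| by rewrite distrC ler_wpM2r// ler_norm.
  move: yz1; rewrite ltr_pdivlMr// /De => h4.
  have := normr_ge0 (y - z); lra.
move=> imp; suff : false by []; apply: imp => s /andP[s0 s1] nN.
have sz : ball x r (z + s *: v) by apply: seg; rewrite !ltW.
have Os := xrO _ sz.
have us : regular_pt u (z + s *: v).
  by apply: contrapT => h; apply: nN; apply: NP => /= /(_ Os).
split; first by case: us.
by rewrite mul0r addr0; exact: regular_pt_dot (xrL _ sz) us.
Qed.

Lemma test_fun0 : test_fun Omega F (fun=> 0).
Proof.
split; first by exists 0 => y y' _ _; rewrite subrr normr0 mul0r.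
move: Fnorm; apply: filterS => z Fz Oz.
have -> : gradient (fun=> 0) z = 0 :> 'rV[R]_n.
  apply: (first_order_differentiable _).2 => d d0; exists 1 => // h _.
  by rewrite subrr dot0l subrr normr0 mulr_ge0// ltW.
by rewrite (norm_between0 (Fz Oz)).
Qed.

(** For each pair of rational points and each rational threshold, choose a
    test function that exceeds the threshold if there is one. By the common
    local Lipschitz constant this countable family determines the intrinsic
    distance locally, so the exceptional null sets of all test functions can be
    replaced by those of a countable family. *)
Lemma countable_test_funs :
  exists D : 'rV[rat]_n * 'rV[rat]_n * rat -> 'rV[R]_n -> R,
    (forall i, test_fun Omega F (D i)) /\
    forall u (p q : 'rV[rat]_n) (k : rat), test_fun Omega F u ->
      ratr k < u (map_mx ratr p) - u (map_mx ratr q) ->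
      ratr k < D (p, q, k) (map_mx ratr p) - D (p, q, k) (map_mx ratr q).
Proof.
have /choice[D HD] : forall i : 'rV[rat]_n * 'rV[rat]_n * rat, exists d,
    test_fun Omega F d /\ forall u, test_fun Omega F u ->
      ratr i.2 < u (map_mx ratr i.1.1) - u (map_mx ratr i.1.2) ->
      ratr i.2 < d (map_mx ratr i.1.1) - d (map_mx ratr i.1.2).
  move=> [[p q] k] /=.
  have [[u [tu uk]]|nu] := pselect (exists u, test_fun Omega F u /\
      ratr k < u (map_mx ratr p) - u (map_mx ratr q)).
    by exists u.
  exists (fun=> 0); split; first exact: test_fun0.
  by move=> u tu uk; exfalso; apply: nu; exists u.
exists D; split => [i|u p q k tu uk]; first exact: (HD i).1.
exact: (HD (p, q, k)).2 u tu uk.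
Qed.

End norms.
End increments.

Section lower_bound.
Variables (R : realType) (n : nat).
Local Notation leb := (@lebesgue_measure R).
Implicit Types (x y z v p q h : 'rV[R]_n) (u : 'rV[R]_n -> R).
Variables (Omega : set 'rV[R]_n) (F : 'rV[R]_n -> 'rV[R]_n -> R) (lambda : 'rV[R]_n -> R).
Hypothesis oO : open Omega.
Hypothesis lambda1 : forall z, Omega z -> 1 <= lambda z.
Hypothesis lambda_cont : {within Omega, continuous lambda}.
Hypothesis Fnorm : {ae lebN (n:=n), forall z, Omega z ->
  norm_between (F z) (lambda z)^-1 (lambda z * n%:R)}.
Hypothesis F_meas : forall v, measurable_fun (Omega : set (borel_rV R n)) (F ^~ v).
Hypothesis F_ge0 : forall z v, Omega z -> 0 <= F z v.

(** The points z at which w belongs to the dual unit ball of F z. It is tested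
    on rational vectors so that the set is Borel; see polar_set_polar. *)
Definition polar_set (w : 'rV[R]_n) : set (borel_rV R n) :=
  [set z | Omega z /\ forall q : 'rV[rat]_n, `|dot w (map_mx ratr q)| <= F z (map_mx ratr q)].

Lemma measurable_polar_set w : measurable (polar_set w).
Proof.
have mO : measurable (Omega : set (borel_rV R n)) by exact: sub_sigma_algebra.
rewrite [X in measurable X](_ : _ = Omega `&` \bigcap_(q : 'rV[rat]_n)
   (Omega `&` (F ^~ (map_mx ratr q)) @^-1` `[`|dot w (map_mx ratr q)|, +oo[)).
  apply: measurableI => //; rewrite -[X in measurable X]setCK setC_bigcap.
  apply: measurableC; apply: countable_bigcupT_measurable => // q.
  by apply: measurableC; exact: F_meas.
apply/seteqP; split => z /= [Oz H]; split => // q.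
  by move=> _; split => //; rewrite /= in_itv/= andbT.
by have [_] := H q I; rewrite /= in_itv/= andbT.
Qed.

Lemma polar_set_polar w z (c C : R) : norm_between (F z) c C ->
  polar_set w z -> polar (F z) w.
Proof.
move=> Fz [Oz H] q; apply/ler_addgt0Pr => e e0.
have [->|q0] := eqVneq q 0; first by rewrite dot0r normr0 (norm_between0 Fz) add0r ltW.
have K0 : 0 < n%:R * `|w| + C by rewrite ltr_wpDl ?mulr_ge0// (norm_between_upper_gt0 Fz q0).
have [r qr] := exists_rational_near q (divr_gt0 e0 K0).
set q' := map_mx ratr r in qr.
have h1 : `|dot w q| <= `|dot w q'| + n%:R * `|w| * `|q - q'|.
  rewrite -{1}(subrK q' q) dotDr addrC (le_trans (ler_normD _ _))// lerD2l.
  exact: dot_le.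
have h2 := H r; rewrite -/q' in h2.
have := norm_between_dist Fz q q'; rewrite ler_norml => /andP[h3 _].
move: qr; rewrite ltr_pdivlMr// => /ltW h4.
lra.
Qed.

Lemma gradientN u z : differentiable u z ->
  differentiable (fun y => - u y) z /\ gradient (fun y => - u y) z = - gradient u z.
Proof.
move=> du; apply: first_order_differentiable => e e0.
have [d d0 H] := differentiable_first_order du e0; exists d => // h hd.
rewrite dotNl opprK (_ : _ + _ = - (u (z + h) - u z - dot (gradient u z) h)); last by ring.
by rewrite normrN; exact: H.
Qed.

(** The vector w lies in the unit ball of the infinitesimal form of the
    intrinsic distance at x. *)
Definition slow_direction x (w : 'rV[R]_n) := forall e, 0 < e ->
  \forall t \near 0^'+, (intrinsic_dist Omega F x (x + t *: w) <= (t * (1 + e))%:E)%E.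

Lemma ball_in_bounded x : Omega x -> exists r La, [/\ 0 < r, 0 <= La, ball x r `<=` Omega &
  forall z, ball x r z -> lambda z <= La].
Proof.
move=> Ox; have xO : nbhs x Omega by exact: open_nbhs_nbhs.
have lL := within_continuous_bounded oO Ox lambda_cont.
have : \forall z \near x, Omega z /\ lambda z <= lambda x + 1.
  by move: xO lL; apply: filterS2 => z Oz h; split => //; exact: h.
move=> /nbhs_ballP[r /= r0 H]; exists r, (lambda x + 1); split => //.
- by rewrite addr_ge0// (le_trans ler01)// lambda1.
- by move=> z /H[].
- by move=> z /H[].
Qed.

Lemma exists_rational_in_ball x (r s : R) y : 0 < s -> ball x r y ->
  exists q : 'rV[rat]_n, `|y - map_mx ratr q| < s /\ ball x r (map_mx ratr q).
Proof.
rewrite -ball_normE/= => s0 xy.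
have [|q] := @exists_rational_near _ _ y (Num.min s (r - `|x - y|)).
  by rewrite lt_min s0 subr_gt0.
rewrite lt_min => /andP[h1 h2]; exists q; split => //.
rewrite -(subrK y x) -addrA (le_lt_trans (ler_normD _ _))//.
by rewrite -ltrBrDl.
Qed.

(** At a regular point of a test function u, the slope of u along w is at
    most 1 if the point belongs to polar_set w, and at most M otherwise. At a
    density point of polar_set w on its line, the points of the second kind
    contribute only a small proportion of the segment, so the mean value
    inequality bounds the increment of u by t (1 + e). This applies for almost
    every x to the countable family of test functions, and extends to all test
    functions by approximating x and x + t w by rational points. *)
Lemma slow_direction_ae (w : 'rV[R]_n) :
  {ae lebN (n:=n), forall x, polar_set w x -> slow_direction x w}.
Proof.
have mA := measurable_polar_set w.
have [D [tD HD]] := countable_test_funs Fnorm.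
have /choice[N HN] : forall i, exists N : set (borel_rV R n),
    [/\ measurable N, lebN N = 0%E & ~` [set z | Omega z -> regular_pt F lambda (D i) z] `<=` N].
  by move=> i; have [N [N1 N2 N3]] := test_fun_regular oO Fnorm (tD i); exists N.
have aeN : {ae lebN (n:=n), forall x, forall i, leb (line_trace (N i) w x) = 0%E}.
  by apply: ae_forall_countable => i; have [mN N0 _] := HN i; exact: null_ae_line.
move: (line_density w mA) aeN; apply: filterS2 => x dens xN Ax e e0.
have Ox : Omega x by case: Ax.
have [r [La [r0 La0 rO rL]]] := ball_in_bounded Ox.
pose M := n%:R * La * `|w|.
have M0 : 0 <= M by rewrite !mulr_ge0.
have M1 : 0 < 2 * M + 1 by rewrite ltr_wpDl// mulr_ge0.
pose c := e / (2 * M + 1).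
have c0 : 0 < c by rewrite divr_gt0.
have [d /= d0 Hd] := dens Ax _ c0.
have w1 : 0 < `|w| + 1 by rewrite ltr_wpDl.
near=> t.
have t0 : 0 < t by [].
have t2d : 2 * t < d.
  by rewrite mulrC -ltr_pdivlMr//; near: t; apply: nbhs_right_lt; rewrite divr_gt0.
have twr : t * (`|w| + 1) < r.
  by rewrite -ltr_pdivlMr//; near: t; apply: nbhs_right_lt; rewrite divr_gt0.
have seg s : 0 <= s <= t -> ball x r (x + s *: w).
  move=> /andP[s0 st]; rewrite -ball_normE/= opprD addrA subrr sub0r normrN normrZ ger0_norm//.
  rewrite (le_lt_trans _ twr)//; apply: ler_pM => //; by rewrite lerDl.
have xt : ball x r (x + t *: w) by apply: seg; rewrite lexx ltW.
have xx : ball x r x by exact: ballxx.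
pose B : set R := line_trace (polar_set w) w x.
have mB : measurable B by exact: measurable_line_trace.
have defect : (leb (`]0%R, t] `\` B) <= (c * (2 * t))%:E)%E.
  apply: le_trans (Hd (2 * t) _ _); last 2 first.
  - by rewrite /ball/= sub0r normrN gtr0_norm ?mulr_gt0.
  - by rewrite mulr_gt0.
  apply: le_measure; rewrite ?inE.
  - by apply: measurableD => //; exact: measurable_itv.
  - by apply: measurableD => //; exact: measurable_ball.
  apply: setSD => s /=; rewrite in_itv/= /ball/= sub0r normrN => /andP[s0 st].
  by rewrite gtr0_norm// (le_lt_trans st)// mulr_natl mulr2n ltrDl.
have step i : D i x - D i (x + t *: w) <= t * (1 + e).
  have [mN N0 NP] := HN i.
  have lD : lipschitz_in Omega (fun y => - D i y).
    have [L HL] := (tD i).1; exists L => y z Oy Oz.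
    by rewrite opprK addrC distrC; exact: HL.
  have segO s : 0 <= s <= t -> Omega (x + s *: w) by move=> /seg /rO.
  have slope s : 0 < s < t -> ~ N i (x + s *: w) ->
      differentiable (fun y => - D i y) (x + s *: w) /\
      dot (gradient (fun y => - D i y) (x + s *: w)) w <= 1 + M * (s \notin B)%:R.
    move=> /andP[sp st] nN; have bs : ball x r (x + s *: w) by apply: seg; rewrite !ltW.
    have Os := rO _ bs.
    have rs : regular_pt F lambda (D i) (x + s *: w).
      by apply: contrapT => nr; apply: nN; apply: NP => /= /(_ Os).
    have [Fs ds F1] := rs.
    have [dNs ->] := gradientN ds; split => //.
    have [/set_mem Bs|Bs] := boolP (s \in B).
      rewrite mulr0 addr0 dotNl dotC (le_trans (ler_norm _))// normrN.
      exact: le_trans (polar_set_polar Fs Bs _) F1.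
    rewrite mulr1 dotNl -dotNr (le_trans (regular_pt_dot lambda1 (- w) Os (rL _ bs) rs))//.
    by rewrite normrN lerDr.
  have inc := increment_le_along oO lD t0 segO mN (xN i) mB ler01 M0 slope.
  have inc' : ((- D i (x + t *: w) - - D i x)%:E <=
      (1 * t)%:E + M%:E * (c * (2 * t))%:E)%E.
    by apply: le_trans inc _; rewrite leeD2l// lee_wpmul2l// lee_fin.
  have cM : c * (2 * M + 1) = e by rewrite divfK// gt_eqF.
  move: inc'; rewrite -EFinM -EFinD lee_fin mul1r => inc'.
  have : t * (2 * c * M) <= t * e by rewrite ler_wpM2l ?(ltW t0)// -cM; lra.
  lra.
rewrite intrinsic_distE//; apply: ge_ereal_sup => _ [u tu <-]; rewrite lee_fin leNgt.
apply/negP => uK.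
pose De := u x - u (x + t *: w) - t * (1 + e).
have De0 : 0 < De by rewrite subr_gt0.
pose K := n%:R * La; have K0 : 0 <= K by rewrite mulr_ge0.
have K1 : 0 < 4 * K + 1 by rewrite ltr_wpDl// mulr_ge0.
pose s := De / (4 * K + 1); have s0 : 0 < s by rewrite divr_gt0.
have sK : s * (4 * K + 1) = De by rewrite divfK// gt_eqF.
have [p [xp bp]] := exists_rational_in_ball s0 xx.
have [q [xq bq]] := exists_rational_in_ball s0 xt.
set p' := map_mx ratr p in xp bp; set q' := map_mx ratr q in xq bq.
have lip u' y y' : test_fun Omega F u' -> ball x r y -> ball x r y' -> u' y' - u' y <= K * `|y' - y|.
  by move=> tu' hy hy'; exact: (test_fun_lipschitz_on_ball oO lambda1 Fnorm rO rL La0 tu' hy hy').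
have xpK : K * `|x - p'| <= K * s by rewrite ler_wpM2l// ltW.
have xqK : K * `|x + t *: w - q'| <= K * s by rewrite ler_wpM2l// ltW.
have [|k] := @rat_in_itvoo R (t * (1 + e) + 2 * (K * s)) (t * (1 + e) + De - 2 * (K * s)).
  by rewrite -sK; lra.
rewrite in_itv/= => /andP[k1 k2].
have l1 := lip u p' x tu bp xx.
have l2 := lip u (x + t *: w) q' tu xt bq; rewrite (distrC q') in l2.
have uk : ratr k < u p' - u q' by rewrite /De in k2; lra.
have dk := HD u p q k tu uk; rewrite -/p' -/q' in dk.
have st := step (p, q, k).
have l3 := lip _ x p' (tD (p, q, k)) xx bp; rewrite (distrC p') in l3.
have l4 := lip _ q' (x + t *: w) (tD (p, q, k)) bq xt.
lra.
Unshelve. all: by end_near. Qed.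

End lower_bound.

Section lip_lower.
Variables (R : realType) (n : nat).
Implicit Types (x y z v p q h : 'rV[R]_n) (u : 'rV[R]_n -> R).
Variables (Omega : set 'rV[R]_n) (F : 'rV[R]_n -> 'rV[R]_n -> R) (lambda : 'rV[R]_n -> R).
Hypothesis oO : open Omega.
Hypothesis Fnorm : {ae lebN (n:=n), forall z, Omega z ->
  norm_between (F z) (lambda z)^-1 (lambda z * n%:R)}.
Hypothesis F_ge0 : forall z v, Omega z -> 0 <= F z v.
Local Notation delta := (intrinsic_dist Omega F).

Lemma intrinsic_dist_ge0 x y : (0 <= delta x y)%E.
Proof.
rewrite intrinsic_distE//; apply: ereal_sup_ubound; exists (fun=> 0).
  exact: test_fun0 Fnorm.
by rewrite subrr.
Qed.

Lemma ereal_div_ge (a b d : R) (t : \bar R) : 0 < a -> (0 <= t)%E -> (t <= d%:E)%E ->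
  0 <= b -> b * d <= a -> (b%:E <= a%:E / t)%E.
Proof.
move=> a0 t0 td b0 ab; case: t t0 td => [s| |]//; rewrite !lee_fin => s0 sd.
rewrite inver; case: eqP => [_|/eqP sn0].
  by rewrite gt0_muley ?lte_fin// leey.
have sp : 0 < s by rewrite lt_neqAle eq_sym sn0.
rewrite -EFinM lee_fin ler_pdivlMr// (le_trans _ ab)//.
by rewrite ler_wpM2l.
Qed.

Lemma near_ray x v (V : set 'rV[R]_n) : Omega x -> v != 0 ->
  (within Omega x^') V -> \forall t \near (0:R)^'+, V (x + t *: v).
Proof.
move=> Ox v0 VF.
have xO : nbhs x Omega by exact: open_nbhs_nbhs.
have VF' : nbhs x [set y | y != x -> Omega y -> V y] by exact: VF.
have : nbhs x [set y | y != x -> V y].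
  by move: xO VF'; apply: filterS2 => y Oy h yx; exact: h.
move=> /nbhs_ballP[r /= r0 H].
have nv : 0 < `|v| by rewrite normr_gt0.
near=> t; have t0 : 0 < t by [].
apply: H.
  rewrite -ball_normE/= opprD addrA subrr sub0r normrN normrZ gtr0_norm//.
  rewrite -ltr_pdivlMr//; near: t; apply: nbhs_right_lt; exact: divr_gt0.
by rewrite -subr_eq0 addrAC subrr add0r scaler_eq0 negb_or gt_eqF.
Unshelve. all: by end_near. Qed.

Lemma pointwise_lip_ge0 u x : (0 < n)%N -> Omega x -> (0 <= pointwise_lip Omega delta u x)%E.
Proof.
move=> n0 Ox; apply: le_ereal_inf_tmp => _ [V VF <-].
have e0 : delta_mx ord0 (Ordinal n0) != 0 :> 'rV[R]_n.
  by rewrite -normr_gt0 -(scale1r (delta_mx _ _)) normr_scale_delta normr1.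
have nV := near_ray Ox e0 VF.
near (0:R)^'+ => t.
have Vy : V (x + t *: delta_mx ord0 (Ordinal n0)) by near: t.
apply: (@le_trans _ _ (`|u (x + t *: delta_mx ord0 (Ordinal n0)) - u x|%:E /
  delta x (x + t *: delta_mx ord0 (Ordinal n0)))%E).
  by apply: mule_ge0; [rewrite lee_fin|rewrite inve_ge0 intrinsic_dist_ge0].
by apply: ereal_sup_ubound; exists (x + t *: delta_mx ord0 (Ordinal n0)).
Unshelve. all: by end_near. Qed.

(** Approach x along w: the increment of u is about t <w, p>, where p is the
    gradient, and the distance travelled is at most about t. *)
Lemma pointwise_lip_ge u x w (c : R) : Omega x -> differentiable u x ->
  slow_direction Omega F x w -> 0 <= c -> c < dot w (gradient u x) ->
  (c%:E <= pointwise_lip Omega delta u x)%E.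
Proof.
move=> Ox du sw c0; set p := gradient u x => cp.
have w0 : w != 0 by apply: contraTneq cp => ->; rewrite dot0l -leNgt.
have nw : 0 < `|w| by rewrite normr_gt0.
pose c' := (c + dot w p) / 2.
have cc' : c < c' by rewrite /c'; lra.
have c'p : c' < dot w p by rewrite /c'; lra.
have c'0 : 0 < c' by exact: le_lt_trans cc'.
have c1 : 0 < c + 1 by rewrite ltr_wpDl.
pose e := (c' - c) / (c + 1).
have e0 : 0 < e by rewrite divr_gt0// subr_gt0.
have ce : c * (1 + e) <= c'.
  have : e * (c + 1) = c' - c by rewrite divfK// gt_eqF.
  by move=> E; nra.
have wpc' : 0 < (dot w p - c') / `|w| by rewrite divr_gt0// subr_gt0.
have [d d0 Hd] := differentiable_first_order du wpc'.
apply: le_ereal_inf_tmp => _ [V VF <-].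
have nV := near_ray Ox w0 VF.
have nS := sw e e0.
near (0:R)^'+ => t; have t0 : 0 < t by [].
have Vy : V (x + t *: w) by near: t.
have dt : (delta x (x + t *: w) <= (t * (1 + e))%:E)%E by near: t.
have td : `|t *: w| < d.
  rewrite normrZ gtr0_norm// -ltr_pdivlMr//; near: t; apply: nbhs_right_lt.
  exact: divr_gt0.
apply: (@le_trans _ _ (`|u (x + t *: w) - u x|%:E / delta x (x + t *: w))%E); last first.
  by apply: ereal_sup_ubound; exists (x + t *: w).
have inc : t * c' <= `|u (x + t *: w) - u x|.
  rewrite (le_trans _ (ler_norm _))//.
  have := Hd _ td; rewrite -/p dotZr (dotC p) normrZ (gtr0_norm t0) ler_norml => /andP[h _].
  have E : (dot w p - c') / `|w| * (t * `|w|) = t * (dot w p - c').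
    by rewrite mulrCA divfK// gt_eqF.
  rewrite E in h; lra.
apply: (@ereal_div_ge _ _ (t * (1 + e))) => //.
- by rewrite (lt_le_trans _ inc)// mulr_gt0.
- exact: intrinsic_dist_ge0.
- by rewrite (le_trans _ inc)// mulrCA ler_pM2l.
Unshelve. all: by end_near. Qed.

End lip_lower.

Theorem theorem1p1 (R : realType) (n : nat) (hn : (2 <= n)%N)
  (Omega : set 'rV[R]_n) (hOmega : is_domain Omega)
  (F : 'rV[R]_n -> 'rV[R]_n -> R) (hF : admissible Omega F)
  (hF_usc : finsler_weak_usc Omega F)
  (u : 'rV[R]_n -> R) (hu : lipschitz_in Omega u) :
  ae_in Omega (fun x =>
    pointwise_lip Omega (intrinsic_dist Omega F) u x =
    (F x (gradient u x))%:E).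
Proof.
have oO : open Omega by case: hOmega.
have n0 : (0 < n)%N by exact: ltn_trans hn.
have F_ge0 z v : Omega z -> 0 <= F z v by exact: (finsler_ge0 hF).
have F_meas v : measurable_fun (Omega : set (borel_rV R n)) (F ^~ v).
  exact: (finsler_measurable hF).
have [lambda [lambda_cont lambda1 Fnorm]] := admissible_norm_between hF.
have usc : {ae lebN (n:=n), forall x, forall v : 'rV[rat]_n, Omega x ->
    usc_at Omega (F ^~ (map_mx ratr v)) x}.
  by apply: ae_forall_countable => v; exact: hF_usc.
have slow : {ae lebN (n:=n), forall x, forall w : 'rV[rat]_n,
    polar_set Omega F (map_mx ratr w) x -> slow_direction Omega F x (map_mx ratr w)}.
  by apply: ae_forall_countable => w; exact: (slow_direction_ae oO lambda1 lambda_cont Fnorm F_meas F_ge0 (map_mx ratr w)).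
have du := lipschitz_in_ae_differentiable oO hu.
have reg : {ae lebN (n:=n), forall x, Omega x ->
    norm_between (F x) (lambda x)^-1 (lambda x * n%:R) /\ differentiable u x}.
  by move: Fnorm du; apply: filterS2 => x a b Ox; split; [exact: a|exact: b].
move: reg usc slow; rewrite /ae_in; apply: filterS3 => x regx uscx slowx Ox.
have [Fx dux] := regx Ox.
have l0 : 0 < lambda x by rewrite (lt_le_trans ltr01)// lambda1.
have l10 : 0 <= lambda x + 1 by rewrite addr_ge0// ltW.
apply/eqP; rewrite eq_le; apply/andP; split.
  have ln : 0 < lambda x * n%:R by rewrite mulr_gt0// ltr0n.
  have uscx' (v : 'rV[rat]_n) : usc_at Omega (F ^~ (map_mx ratr v)) x by exact: uscx.
  have lLa := within_continuous_bounded oO Ox lambda_cont.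
  exact: (pointwise_lip_le Ox Fx ln Fnorm uscx' lLa l10 F_ge0 dux).
apply/lee_subgt0Pr => e e0.
have [c0|c0] := leP 0 (F x (gradient u x) - e); last first.
  apply: (@le_trans _ _ 0%E); first by rewrite -EFinB lee_fin ltW.
  exact: (pointwise_lip_ge0 oO Fnorm F_ge0 u n0 Ox).
have ce : F x (gradient u x) - e < F x (gradient u x) by rewrite gtrBl.
have [w wF wp] := norm_separation_rat Fx c0 ce.
apply: (pointwise_lip_ge oO Fnorm F_ge0 Ox dux _ c0 wp).
by apply: slowx; split => // q; exact: wF.
Qed.
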